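(* Real Value Perception Manipulation (RVPM) can be solved in polynomial time under the $l_2$ norm when the number of issues $d$ is a constant, for constructive control and arbitrary scoring rules.
   Context: Spatial election model: $n$ candidates $c_1,\dots,c_n$ and $m$ voters $v_1,\dots,v_m$ are points of $\mathbb R^d$. Each voter ranks candidates by increasing Euclidean ($l_2$) distance; closest ranked 1; original rankings have no ties. A scoring rule is a non-increasing $f:\{1,\dots,n\}\to\mathbb R$: a candidate ranked $t$ by a voter receives $f(t)$; totals summed; highest total wins. Given $\epsilon>0$, an adversary may replace target $c_1$ by any $\tilde c_1\in\mathbb R^d$ with $\|\tilde c_1-c_1\|_2\le\epsilon$; ties created by the manipulation are broken in the adversary's favor. Constructive control: decide whether some such $\tilde c_1$ makes $c_1$ win (with $c_1$ placed ahead of equidistant candidates, its total is at least every other candidate's total). *)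

(* Defs.v *)
From HB Require Import structures.
From mathcomp Require Import all_boot all_order all_algebra.
From mathcomp Require Import reals.
Set Implicit Arguments. Unset Strict Implicit. Unset Printing Implicit Defensive.
Import Order.TTheory GRing.Theory Num.Theory.
Local Open Scope ring_scope.

(* Candidates are indexed by 'I_n.+1 (so there are n+1 >= 1 candidates);   *)
(* the target c_1 of the paper is the candidate ord0.                      *)

(* squared Euclidean (l_2) distance; comparing squared distances is the
   same as comparing l_2 distances *)
Definition dist2 (R : realType) (d : nat) (x y : 'rV[R]_d) : R :=
  \sum_(k < d) (x 0 k - y 0 k) ^+ 2.

Definition no_ties (R : realType) (d n m : nat)
    (c : 'I_n.+1 -> 'rV[R]_d) (v : 'I_m -> 'rV[R]_d) : Prop :=
  forall j a b, a != b -> dist2 (v j) (c a) != dist2 (v j) (c b).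

Definition scoring_rule (R : realType) (N : nat) (f : nat -> R) : Prop :=
  forall s t, (1 <= s)%N -> (s <= t)%N -> (t <= N)%N -> f t <= f s.

(* positions after moving the target to ct : voter v places b ahead of a iff
   b is strictly closer, or b is the target and is equidistant
   (ties created by the manipulation are broken in favour of the target) *)
Definition moved (R : realType) (d n : nat) (c : 'I_n.+1 -> 'rV[R]_d)
    (ct : 'rV[R]_d) (a : 'I_n.+1) : 'rV[R]_d :=
  if a == ord0 then ct else c a.

Definition ahead (R : realType) (d n : nat) (c' : 'I_n.+1 -> 'rV[R]_d)
    (x : 'rV[R]_d) (b a : 'I_n.+1) : bool :=
  (b != a) &&
  ((dist2 x (c' b) < dist2 x (c' a)) ||
   ((b == ord0) && (dist2 x (c' b) == dist2 x (c' a)))).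

Definition rank (R : realType) (d n : nat) (c' : 'I_n.+1 -> 'rV[R]_d)
    (x : 'rV[R]_d) (a : 'I_n.+1) : nat :=
  #|[pred b | ahead c' x b a]|.+1.

Definition score (R : realType) (d n m : nat) (f : nat -> R)
    (c' : 'I_n.+1 -> 'rV[R]_d) (v : 'I_m -> 'rV[R]_d) (a : 'I_n.+1) : R :=
  \sum_(j < m) f (rank c' (v j) a).

Definition RVPM_constructive (R : realType) (d n m : nat)
    (c : 'I_n.+1 -> 'rV[R]_d) (v : 'I_m -> 'rV[R]_d) (f : nat -> R) (eps : R)
    : Prop :=
  exists ct : 'rV[R]_d,
    dist2 ct (c ord0) <= eps ^+ 2 /\
    forall a : 'I_n.+1, score f (moved c ct) v a <= score f (moved c ct) v ord0.

(* Part 2: the computational model -- a real RAM (BSS-style machine with   *)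
(* unit-cost exact real arithmetic and comparisons, no floor), with an      *)
(* auxiliary bank of natural-number registers/memory for indices and         *)
(* addressing (addition, truncated subtraction, comparison only).           *)

Inductive instr : Type :=
| NConst (r k : nat)
| NAdd (r a b : nat)
| NSub (r a b : nat)        (* N[r] := N[a] - N[b] (truncated) *)
| NLoad (r a : nat)
| NStore (a r : nat)
| NJumpLe (a b l : nat)
| RZero (r : nat)
| ROne (r : nat)
| RAdd (r a b : nat)
| RSub (r a b : nat)
| RMul (r a b : nat)
| RDiv (r a b : nat)        (* X[r] := X[a] / X[b]  (x / 0 = 0) *)
| RLoad (r a : nat)
| RStore (a r : nat)
| RJumpLt (a b l : nat)
| RJumpLe (a b l : nat)
| Jump (l : nat)
| Halt (b : bool).

Record state (R : realType) : Type := State {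
  pc : nat;
  nreg : nat -> nat;
  nmem : nat -> nat;
  rreg : nat -> R;
  rmem : nat -> R }.

Definition upd (T : Type) (g : nat -> T) (i : nat) (x : T) : nat -> T :=
  fun j => if j == i then x else g j.

Definition step (R : realType) (i : instr) (s : state R) : state R :=
  let: State p N NM X M := s in
  match i with
  | NConst r k => State p.+1 (upd N r k) NM X M
  | NAdd r a b => State p.+1 (upd N r (N a + N b)%N) NM X M
  | NSub r a b => State p.+1 (upd N r (N a - N b)%N) NM X M
  | NLoad r a => State p.+1 (upd N r (NM (N a))) NM X M
  | NStore a r => State p.+1 N (upd NM (N a) (N r)) X M
  | NJumpLe a b l => State (if (N a <= N b)%N then l else p.+1) N NM X M
  | RZero r => State p.+1 N NM (upd X r 0) M
  | ROne r => State p.+1 N NM (upd X r 1) M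
  | RAdd r a b => State p.+1 N NM (upd X r (X a + X b)) M
  | RSub r a b => State p.+1 N NM (upd X r (X a - X b)) M
  | RMul r a b => State p.+1 N NM (upd X r (X a * X b)) M
  | RDiv r a b => State p.+1 N NM (upd X r (X a / X b)) M
  | RLoad r a => State p.+1 N NM (upd X r (M (N a))) M
  | RStore a r => State p.+1 N NM X (upd M (N a) (X r))
  | RJumpLt a b l => State (if X a < X b then l else p.+1) N NM X M
  | RJumpLe a b l => State (if X a <= X b then l else p.+1) N NM X M
  | Jump l => State l N NM X M
  | Halt _ => s
  end.

(* run P t s = Some b iff P halts with answer b within t steps
   (each instruction, including Halt, costs one step); a program counter
   outside the program means the machine is stuck (no answer). *)
Fixpoint run (R : realType) (P : seq instr) (t : nat) (s : state R)
    : option bool :=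
  match t with
  | 0 => None
  | t'.+1 =>
      match nth None (map Some P) (pc s) with
      | None => None
      | Some (Halt b) => Some b
      | Some i => run P t' (step i s)
      end
  end.

(* Encoding of an instance as the machine's input.
   Natural registers: N[0] = n.+1 (number of candidates), N[1] = m.
   Real memory (N_c := n.+1):
     M[i*d + k]                  = k-th coordinate of candidate i
     M[N_c*d + j*d + k]          = k-th coordinate of voter j
     M[N_c*d + m*d + (t-1)]      = f(t),  1 <= t <= N_c
     M[N_c*d + m*d + N_c]        = eps
   everything else is 0. *)
Definition coord (R : realType) (d : nat) (x : 'rV[R]_d) (k : nat) : R :=
  if @insub nat (fun k => k < d)%N 'I_d k is Some i then x 0 i else 0.

Definition input_mem (R : realType) (d n m : nat)
    (c : 'I_n.+1 -> 'rV[R]_d) (v : 'I_m -> 'rV[R]_d) (f : nat -> R) (eps : R)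
    (addr : nat) : R :=
  let Nc := n.+1 in
  if (addr < Nc * d)%N then
    coord (c (inord (addr %/ d)%N)) (addr %% d)%N
  else let a1 := (addr - Nc * d)%N in
  if (a1 < m * d)%N then
    (if @insub nat (fun j => j < m)%N 'I_m (a1 %/ d)%N is Some j
     then coord (v j) (a1 %% d)%N else 0)
  else let a2 := (a1 - m * d)%N in
  if (a2 < Nc)%N then f a2.+1
  else if a2 == Nc then eps else 0.

Definition init_state (R : realType) (d n m : nat)
    (c : 'I_n.+1 -> 'rV[R]_d) (v : 'I_m -> 'rV[R]_d) (f : nat -> R) (eps : R)
    : state R :=
  State 0 (upd (upd (fun _ => 0%N) 0 n.+1) 1 m) (fun _ => 0%N)
        (fun _ => 0) (input_mem c v f eps).

(* Main.v *)
Require Import Defs.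
From HB Require Import structures.
From mathcomp Require Import all_boot all_order all_algebra.
From mathcomp Require Import reals.
From mathcomp Require Import classical_sets topology normedtype derive.
From mathcomp Require Import ring lra zify.
Import Order.TTheory GRing.Theory Num.Theory.
Import numFieldNormedType.Exports.
Set Implicit Arguments. Unset Strict Implicit. Unset Printing Implicit Defensive.
Local Open Scope ring_scope.

(** Moving the target to [x] puts it ahead of candidate [a] for voter [j] exactly
    when [x] lies in the closed ball around [v j] through [c a], and the target's
    chances only improve when [x] lies in more of these balls. So let [x] be a
    winning position, and consider all the balls that contain it, among them the
    ball of radius [eps] around the original position. The minimizer [w] of the
    maximum of their powers [|x - v|^2 - r^2] also lies in all of them, hence wins.
    By convex duality [w] is in the convex hull of the centers of the balls that
    attain the maximum; it is therefore the radical center, inside the affine hull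
    of the centers, of at most [d + 1] of these balls, which Gram-Schmidt
    orthogonalization computes with field operations only (no square roots). The
    machine tries all [(d + 1)]-tuples of balls and tests the resulting points. *)

(** * Radical centers *)

(** Ties favor the target, so only closed conditions have to be kept, and no cell of the arrangement
    of spheres has to be identified. The obvious points of an intersection of balls, where several
    spheres meet, need square roots, which the machine lacks. Powers avoid them: the difference of
    two powers is affine, so equality of powers is a linear system. The number [d + 1] counts one
    base ball and a basis of at most [d] directions between centers. A tuple may repeat balls, which
    is why a single fixed length suffices. No tuple has to be certified: each computed point is
    tested against the definition of winning itself, so a useless tuple does no harm. *)

Section Geometry.
Variables (R : realType) (d : nat).
Implicit Types (x y z u w : 'rV[R]_d).

Definition dotv x y : R := \sum_(k < d) x 0 k * y 0 k.

Lemma dotvC x y : dotv x y = dotv y x.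
Proof. by apply: eq_bigr => k _; rewrite mulrC. Qed.

Lemma dotvDl x y z : dotv (x + y) z = dotv x z + dotv y z.
Proof. by rewrite -big_split; apply: eq_bigr => k _; rewrite !mxE mulrDl. Qed.

Lemma dotvDr x y z : dotv z (x + y) = dotv z x + dotv z y.
Proof. by rewrite dotvC dotvDl !(dotvC z). Qed.

Lemma dotvZl a x y : dotv (a *: x) y = a * dotv x y.
Proof. by rewrite mulr_sumr; apply: eq_bigr => k _; rewrite !mxE mulrA. Qed.

Lemma dotvZr a x y : dotv y (a *: x) = a * dotv y x.
Proof. by rewrite dotvC dotvZl dotvC. Qed.

Lemma dotvNl x y : dotv (- x) y = - dotv x y.
Proof. by rewrite -scaleN1r dotvZl mulN1r. Qed.

Lemma dotvNr x y : dotv y (- x) = - dotv y x.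
Proof. by rewrite dotvC dotvNl dotvC. Qed.

Lemma dotv0l x : dotv 0 x = 0.
Proof. by rewrite -(scale0r 0) dotvZl mul0r. Qed.

Definition dotvE := (dotvDl, dotvDr, dotvNl, dotvNr, dotvZl, dotvZr).

Lemma dotv_suml (I : Type) (r : seq I) (P : pred I) (F : I -> 'rV[R]_d) y :
  dotv (\sum_(i <- r | P i) F i) y = \sum_(i <- r | P i) dotv (F i) y.
Proof.
by elim/big_ind2: _ => [|a b e f <- <-|//]; rewrite ?dotv0l ?dotvDl.
Qed.

Lemma dotv_ge0 x : 0 <= dotv x x.
Proof. by apply: sumr_ge0 => k _; rewrite -expr2 sqr_ge0. Qed.

Lemma dotvv_eq0 x : (dotv x x == 0) = (x == 0).
Proof.
apply/idP/eqP => [|->]; last by rewrite dotv0l eqxx.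
rewrite psumr_eq0 => [/allP h|k _]; last by rewrite -expr2 sqr_ge0.
apply/rowP => k; rewrite mxE; apply/eqP.
by have := h k (mem_index_enum _); rewrite /= mulf_eq0 orbb.
Qed.

Lemma dist2E x y : dist2 x y = dotv (x - y) (x - y).
Proof. by apply: eq_bigr => k _; rewrite !mxE expr2. Qed.

Lemma dist2C x y : dist2 x y = dist2 y x.
Proof. by apply: eq_bigr => k _; rewrite -sqrrN opprB. Qed.

(* A ball is represented by its center and its squared radius. *)
Definition power (B : 'rV[R]_d * R) x : R := dist2 x B.1 - B.2.

(** The quadratic part does not depend on the ball. Hence differences of powers are affine in [x],
    and an average of powers is again of this form. *)
Lemma powerE (B : 'rV[R]_d * R) x :
  power B x = dotv x x - 2 * dotv x B.1 + (dotv B.1 B.1 - B.2).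
Proof. by rewrite /power dist2E !dotvE (dotvC B.1 x); ring. Qed.

(** * Convex duality for the smallest maximum of powers *)

Section Dual.
Variables (k : nat) (B : 'I_k.+1 -> 'rV[R]_d * R).
Implicit Types l : 'rV[R]_k.+1.

Definition simplex : set 'rV[R]_k.+1 :=
  [set l | (forall i, 0 <= l 0 i) /\ \sum_i l 0 i = 1]%classic.

Definition barycenter l : 'rV[R]_d := \sum_i l 0 i *: (B i).1.

(* The Lagrangian dual of minimizing [max_i power (B i) x] over [x]. *)
Definition dual l : R :=
  \sum_i l 0 i * (dotv (B i).1 (B i).1 - (B i).2)
  - dotv (barycenter l) (barycenter l).

Lemma continuous_linear_form n (a : 'I_n -> R) :
  continuous (fun l : 'rV[R]_n => \sum_i l 0 i * a i).
Proof.
apply: continuous_big => [|i _ l]; first exact: add_continuous.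
exact: (cvgMr_tmp (@coord_continuous R 1 n 0 i l)).
Qed.

Lemma simplex_compact : compact simplex.
Proof.
have cpt := @rV_compact R k.+1 (fun=> `[0, 1]%classic)
  (fun=> @segment_compact _ _ _).
apply: (subclosed_compact _ cpt); last first.
  move=> l [l0 l1] i /=; rewrite in_itv /= l0 -l1 (bigD1 i) //=.
  by rewrite lerDl sumr_ge0.
(* The factor [1] gives the sum the shape of [continuous_linear_form]. *)
have -> : simplex = (\bigcap_(i in setT) [set l : 'rV[R]_k.+1 | 0 <= l 0 i]
     `&` [set l : 'rV[R]_k.+1 | \sum_i l 0 i * 1 = 1])%classic.
  apply/seteqP; split=> l [h1 h2]; split.
  - by move=> i _; exact: h1.
  - by move: h2 => /= h2; under eq_bigr do rewrite mulr1.
  - by move=> i; exact: (h1 i).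
  - by move: h2 => /=; under eq_bigr do rewrite mulr1.
apply: closedI.
  apply: closed_bigI => i _.
  have /continuous_closedP h := @coord_continuous R 1 k.+1 0 i.
  exact: (h _ (@closed_ge R 0)).
have /continuous_closedP h := @continuous_linear_form k.+1 (fun=> 1).
exact: (h _ (@closed_eq R 1)).
Qed.

Lemma dual_continuous : continuous dual.
Proof.
have cb i : continuous (fun l => barycenter l 0 i).
  have -> : (fun l => barycenter l 0 i) =
      (fun l => \sum_j l 0 j * (B j).1 0 i).
    apply: boolp.funext => x; rewrite summxE.
    by apply: eq_bigr => j _; rewrite mxE.
  exact: continuous_linear_form.
have cq : continuous (fun l => dotv (barycenter l) (barycenter l)).
  apply: continuous_big => [|i _ l]; first exact: add_continuous.
  exact: (cvgM (cb i l) (cb i l)).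
by move=> l; exact: (cvgB (@continuous_linear_form _ _ l) (cq l)).
Qed.

Lemma dual_argmax :
  exists2 l, simplex l & forall l', simplex l' -> dual l' <= dual l.
Proof.
have [|l] := EVT_max_rV _ simplex_compact
  (continuous_subspaceT dual_continuous).
  exists (delta_mx 0 0); split=> [i|]; first by rewrite mxE ler0n.
  rewrite (bigD1 0) //= big1 ?addr0 ?mxE // => i /negPf ni.
  by rewrite mxE ni.
rewrite inE => sl lmax; exists l => // l' sl'; apply: lmax.
by rewrite inE.
Qed.

(** Take [l] maximizing [dual] and [h = dual l]. The [l]-average of the powers at [x] is
    [|x - w|^2 + h]: at a common point of the balls this forces [h <= 0], and at [w] it shows that
    [h] is a weighted mean of the powers. Optimality of [l] towards each vertex bounds every power
    at [w] by [h], so the powers with nonzero weight must equal their mean. *)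
Lemma minimax :
  exists2 l, simplex l & exists h, let w := barycenter l in
    [/\ forall i, power (B i) w <= h,
        forall i, l 0 i != 0 -> power (B i) w = h
      & forall x, (forall i, power (B i) x <= 0) -> h <= 0].
Proof.
have [l sl lmax] := dual_argmax; exists l => //.
have [l0 l1] := sl.
set w := barycenter l.
have powerS x : \sum_i l 0 i * power (B i) x =
    dotv x x - 2 * dotv x w + \sum_i l 0 i * (dotv (B i).1 (B i).1 - (B i).2).
  under eq_bigr do rewrite powerE mulrDr mulrBr.
  rewrite big_split sumrB /= -mulr_suml l1 mul1r; congr (_ - _ + _).
  rewrite dotvC dotv_suml mulr_sumr; apply: eq_bigr => i _.
  by rewrite dotvZl dotvC; ring.
exists (dual l).
have hE : dual l = \sum_i l 0 i * power (B i) w.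
  by rewrite powerS /dual -/w; ring.
have le_h i : power (B i) w <= dual l.
  rewrite leNgt; apply/negP => lt_h.
  set D := dotv ((B i).1 - w) ((B i).1 - w).
  have D0 : 0 <= D by exact: dotv_ge0.
  pose e := power (B i) w - dual l.
  have e0 : 0 < e by rewrite subr_gt0.
  (* Moving [l] by [t] towards vertex [i] changes [dual] by [t * (e - t * D)]. This [t] makes the
     bracket [2 * t * e > 0], contradicting maximality; the term [2 * e] keeps the denominator
     positive when [D = 0] and gives [t <= 1]. *)
  pose t := e / (2 * e + D).
  have den0 : 0 < 2 * e + D by lra.
  have t0 : 0 < t by rewrite divr_gt0.
  have t1 : t <= 1 by rewrite ler_pdivrMr //; lra.
  pose l' := (1 - t) *: l + t *: delta_mx 0 i.
  have sumd (V : lmodType R) (F : 'I_k.+1 -> V) :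
      \sum_j (delta_mx 0 i : 'rV[R]_k.+1) 0 j *: F j = F i.
    rewrite (bigD1 i) //= big1 ?addr0 ?mxE ?eqxx ?scale1r // => j /negPf nj.
    by rewrite mxE nj andbF scale0r.
  (* Stated for any module, so that it covers the total weight, the constant terms and the
     barycenter alike. *)
  have suml' (V : lmodType R) (F : 'I_k.+1 -> V) :
      \sum_j l' 0 j *: F j = (1 - t) *: (\sum_j l 0 j *: F j) + t *: F i.
    rewrite -sumd !scaler_sumr -big_split; apply: eq_bigr => j _ /=.
    by rewrite !scalerA -scalerDl !mxE.
  have sl' : simplex l'.
    split=> [j|].
      rewrite !mxE addr_ge0 // mulr_ge0 ?subr_ge0 ?l0 ?ler0n //.
      exact: ltW.
    have := suml' _ (fun=> 1 : R^o).
    rewrite /GRing.scale /=.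
    under eq_bigr do rewrite mulr1.
    under [X in _ * X + _]eq_bigr do rewrite mulr1.
    by rewrite l1 => ->; ring.
  have := lmax _ sl'.
  have bE : barycenter l' = w + t *: ((B i).1 - w).
    by rewrite /barycenter suml' -/w scalerBr scalerBl scale1r -addrA (addrC (- _)).
  have := suml' _ (fun j => (dotv (B j).1 (B j).1 - (B j).2) : R^o).
  rewrite /GRing.scale /= => aE.
  rewrite {1}/dual aE bE.
  set A := \sum_j l 0 j * _.
  have dE : dual l = A - dotv w w by [].
  rewrite dE.
  have eE : e = dotv (B i).1 (B i).1 - (B i).2 - A - 2 * dotv w (B i).1
                 + 2 * dotv w w by rewrite /e powerE dE; ring.
  have DE : D = dotv (B i).1 (B i).1 - 2 * dotv w (B i).1 + dotv w w.
    by rewrite /D !dotvE (dotvC _ w); ring.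
  rewrite !dotvE (dotvC (B i).1 w).
  have tE : t * (2 * e + D) = e by rewrite /t divfK // gt_eqF.
  move=> hle.
  have : t * e <= t * (t * D) by rewrite eE DE; nra.
  rewrite ler_pM2l //; nra.
split=> //.
  move=> i li0; apply/eqP; rewrite eq_le le_h /= leNgt; apply/negP => lt_h.
  have : \sum_j l 0 j * power (B j) w < \sum_j l 0 j * dual l.
    rewrite (bigD1 i) //= [ltRHS](bigD1 i) //= ltr_leD //.
      by rewrite ltr_pM2l // lt_def li0 l0.
    by apply: ler_sum => j _; rewrite ler_wpM2l.
  by rewrite -mulr_suml l1 mul1r -hE ltxx.
move=> x px.
have : \sum_i l 0 i * power (B i) x <= 0.
  apply: sumr_le0 => i _; rewrite mulr_ge0_le0 //.
have := dotv_ge0 (x - w); rewrite !dotvE (dotvC w x).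
rewrite powerS /dual -/w; lra.
Qed.

End Dual.

(** * Gram-Schmidt computation of the radical center *)

Definition gs_dir (us : seq 'rV[R]_d) (e : 'rV[R]_d) : 'rV[R]_d :=
  e - \sum_(u <- us) (dotv e u / dotv u u) *: u.

(* Since [x / 0 = 0], a center that is affinely dependent on the previous ones
   adds the direction [0] and leaves the point unchanged. *)
Definition gs_step (B0 : 'rV[R]_d * R) (st : seq 'rV[R]_d * 'rV[R]_d)
    (B : 'rV[R]_d * R) : seq 'rV[R]_d * 'rV[R]_d :=
  let u := gs_dir st.1 (B.1 - B0.1) in
  (u :: st.1,
   st.2 + ((power B st.2 - power B0 st.2) / (2 * dotv u u)) *: u).

Definition radical_center B0 Bs : 'rV[R]_d :=
  (foldl (gs_step B0) ([::], B0.1) Bs).2.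

Lemma gs_dirE us e y : {in us, forall u, dotv y u = 0} ->
  dotv y (gs_dir us e) = dotv y e.
Proof.
move=> h; rewrite /gs_dir dotvDr dotvNr (dotvC y (\sum_(u <- us) _)).
rewrite dotv_suml big_seq big1 ?oppr0 ?addr0 // => u /h yu.
by rewrite dotvZl (dotvC u) yu mulr0.
Qed.

Lemma gs_dir_orth us e : pairwise (fun u u' => dotv u u' == 0) us ->
  {in us, forall u, dotv u (gs_dir us e) = 0}.
Proof.
move=> ous u uus; rewrite dotvC /gs_dir dotvDl dotvNl dotv_suml.
suff -> : forall e : 'rV[R]_d,
    \sum_(u' <- us) dotv ((dotv e u' / dotv u' u') *: u') u = dotv e u.
  by rewrite subrr.
move=> {}e; elim: us u uus ous => //= v us IH u.
rewrite inE big_cons dotvZl => /orP[/eqP ->|uus] /andP[/allP ov ous].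
  rewrite big_seq big1 => [|w /ov /eqP]; last first.
    by rewrite dotvZl (dotvC w) => ->; rewrite mulr0.
  (* A zero direction is orthogonal to everything, so both sides vanish whatever the quotient is. *)
  rewrite addr0; have [/eqP|nz] := eqVneq (dotv v v) 0.
    by rewrite dotvv_eq0 => /eqP ->; rewrite !(dotvC _ 0) !dotv0l mulr0.
  by rewrite divfK.
by rewrite (eqP (ov _ uus)) mulr0 add0r IH.
Qed.

(** The running point is the orthogonal projection of [z] onto the affine span of the centers
    processed so far. That the directions span the differences of centers is expressed through
    orthogonal complements, which spares any computation with spans of sequences. *)
Lemma gs_invariant (k : nat) (E : 'M[R]_(k, d)) B0 Bs z :
    {in Bs, forall B, power B z = power B0 z} ->
    {in Bs, forall B, (B.1 - B0.1 <= E)%MS} ->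
  let st := foldl (gs_step B0) ([::], B0.1) Bs in
  [/\ pairwise (fun u u' => dotv u u' == 0) st.1,
      {in st.1, forall u, dotv (z - st.2) u = 0 /\ (u <= E)%MS},
      (st.2 - B0.1 <= E)%MS
    & forall y, {in st.1, forall u, dotv y u = 0} ->
        {in Bs, forall B, dotv y (B.1 - B0.1) = 0}].
Proof.
elim/last_ind: Bs => [|Bs B IH] hz hE /=.
  by split => //; rewrite subrr sub0mx.
have memB B' : B' \in Bs -> B' \in rcons Bs B.
  by rewrite mem_rcons inE orbC => ->.
have BB : B \in rcons Bs B by rewrite mem_rcons mem_head.
have {IH}[] := IH (fun B' h => hz _ (memB _ h)) (fun B' h => hE _ (memB _ h)).
rewrite foldl_rcons; case: foldl => us w /= ous hu hw hspan.
set e := B.1 - B0.1; set u := gs_dir us e.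
have uo : {in us, forall u', dotv u' u = 0} by exact: gs_dir_orth.
have uE : (u <= E)%MS.
  rewrite addmx_sub ?hE // eqmx_opp big_seq.
  by apply: summx_sub => u' /hu[_ u'E]; exact: scalemx_sub.
set t := _ / _.
(* The powers agree at [z] and their difference is affine, so its value at [w] is
   [2 * dotv (z - w) e]. As [z - w] is orthogonal to the earlier directions, [e] may be replaced by
   [u], and [t] is the coefficient of [z - w] along [u]. *)
have tE : t = dotv (z - w) u / dotv u u.
  rewrite gs_dirE => [|u' /hu[]//].
  rewrite /t invfM mulrA; congr (_ * _).
  have -> : power B w - power B0 w = 2 * dotv (z - w) e.
    by have := hz _ BB; rewrite !powerE /e !dotvE; lra.
  by rewrite mulrC mulKf // pnatr_eq0.
have zu : dotv (z - (w + t *: u)) u = 0.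
  rewrite opprD addrA dotvDl dotvNl dotvZl tE.
  have [/eqP|nz] := eqVneq (dotv u u) 0; last by rewrite divfK // subrr.
  by rewrite dotvv_eq0 => /eqP ->; rewrite !(dotvC _ 0) !dotv0l mulr0 subr0.
split.
- by rewrite /= ous andbT; apply/allP => u' /uo; rewrite dotvC => ->.
- move=> u'; rewrite inE => /orP[/eqP ->|u'us]; first by [].
  have [zu' u'E] := hu _ u'us; split => //.
  by rewrite opprD addrA dotvDl dotvNl dotvZl zu' dotvC uo // mulr0 subr0.
- by rewrite addrAC addmx_sub // scalemx_sub.
- move=> y yo B'; rewrite mem_rcons inE => /orP[/eqP ->|B'Bs]; last first.
    by apply: hspan B'Bs => u' u'us; apply: yo; rewrite inE u'us orbT.
  rewrite -/e -(@gs_dirE us); first by apply: yo; exact: mem_head.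
  by move=> u' u'us; apply: yo; rewrite inE u'us orbT.
Qed.

(** The difference between [z] and the computed point lies in the row space of [E] and is orthogonal
    to it, hence is zero. The last hypothesis is the dual form of the requirement that the
    differences of centers span this row space. *)
Lemma radical_centerE (k : nat) (E : 'M[R]_(k, d)) B0 Bs z :
    {in Bs, forall B, power B z = power B0 z} ->
    {in Bs, forall B, (B.1 - B0.1 <= E)%MS} ->
    (z - B0.1 <= E)%MS ->
    (forall y, {in Bs, forall B, dotv y (B.1 - B0.1) = 0} -> E *m y^T = 0) ->
  radical_center B0 Bs = z.
Proof.
move=> hz hE zE Efull; have [_ hu hw hs] := gs_invariant hz hE.
rewrite /radical_center; move: hu hw hs; case: foldl => us w /= hu hw hs.
have Ez : E *m (z - w)^T = 0.
  by apply: Efull; apply: hs => u /hu[].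
have zwE : (z - w <= E)%MS.
  have -> : z - w = (z - B0.1) - (w - B0.1) by rewrite opprB addrA subrK.
  by rewrite addmx_sub // eqmx_opp.
apply/esym/eqP; rewrite -subr_eq0 -dotvv_eq0.
have [D zw] := submxP zwE.
have : (z - w) *m (z - w)^T = 0 by rewrite {1}zw -mulmxA Ez mulmx0.
move/matrixP => /(_ 0 0); rewrite !mxE => h.
by apply/eqP; rewrite -[RHS]h; apply: eq_bigr => i _; rewrite !mxE.
Qed.

(** The support of [l] may be large, but positivity of the weights has done its work once [minimax]
    is applied. Afterwards only the affine span of the active centers matters, and a basis of its
    directions has at most [d] elements. *)
Lemma common_point_radical_center (k : nat) (B : 'I_k.+1 -> 'rV[R]_d * R) x :
    (forall i, power (B i) x <= 0) ->
  exists i0 (s : 'I_d -> 'I_k.+1), forall i,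
    power (B i) (radical_center (B i0) [seq B (s j) | j <- enum 'I_d]) <= 0.
Proof.
move=> hx; have [l [l0 l1] [h [lew eqw h0]]] := minimax B.
set w := barycenter B l in lew eqw.
have [i0 li0] : exists i, l 0 i != 0.
  apply/existsP; apply: contraT; rewrite negb_exists => /forallP lz.
  move: l1; rewrite big1 => [/esym/eqP|i _]; first by rewrite oner_eq0.
  by have := lz i; rewrite negbK => /eqP.
(* Inactive balls get zero rows, so [E] keeps the full index type and its row space is spanned by
   the active directions. *)
pose E := \matrix_i (if l 0 i != 0 then (B i).1 - (B i0).1 else 0).
have rowE i : row i E = if l 0 i != 0 then (B i).1 - (B i0).1 else 0.
  by rewrite rowK.
(* The independent rows number [\rank E <= d]; the remaining positions are padded with [i0].
   Redirecting inactive indices to [i0] in [s] makes every selected ball active and still matches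
   the row of [E], which is then zero. *)
pose g (j : 'I_d) := if insub (val j) is Some r then maxrankfun E r else i0.
pose s j := if l 0 (g j) != 0 then g j else i0.
have sn0 j : l 0 (s j) != 0 by rewrite /s; case: ifP.
have sE j : (B (s j)).1 - (B i0).1 = row (g j) E.
  by rewrite rowE /s; case: ifP => // _; rewrite subrr.
exists i0, s => i.
suff -> : radical_center (B i0) [seq B (s j) | j <- enum 'I_d] = w.
  exact: le_trans (lew i) (h0 _ hx).
apply: (@radical_centerE _ E).
- by move=> _ /mapP[j _ ->]; rewrite !eqw.
- by move=> _ /mapP[j _ ->]; rewrite sE row_sub.
- have -> : w - (B i0).1 = \sum_i l 0 i *: row i E.
    rewrite -[(B i0).1]scale1r -l1 scaler_suml -sumrB.
    apply: eq_bigr => j _; rewrite rowE -scalerBr.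
    by case: eqVneq => // ->; rewrite !scale0r.
  by apply: summx_sub => j _; rewrite scalemx_sub // row_sub.
move=> y hy; have [D ED] : exists D, E = D *m rowsub (maxrankfun E) E.
  by apply/submxP; rewrite eq_maxrowsub.
rewrite ED -mulmxA (_ : rowsub _ _ *m _ = 0) ?mulmx0 //.
apply/matrixP => r c; rewrite !mxE (ord1 c).
have rd : (r < d)%N by rewrite (leq_trans (ltn_ord r)) // rank_leq_col.
have := hy _ (map_f (fun j => B (s j)) (mem_enum _ (Ordinal rd))).
have -> : (B (s (Ordinal rd))).1 - (B i0).1 = row (maxrankfun E r) E.
  rewrite sE /g; case: insubP => [r' _ /= e|]; last by rewrite /= ltn_ord.
  by rewrite (_ : r' = r) //; exact/val_inj.
by move=> yE0; rewrite -[RHS]yE0; apply: eq_bigr => j _; rewrite !mxE mulrC.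
Qed.
End Geometry.

(** * Monotonicity of winning *)

Section Election.
Variables (R : realType) (d n m : nat).
Variables (c : 'I_n.+1 -> 'rV[R]_d) (v : 'I_m -> 'rV[R]_d) (f : nat -> R).

(** [scoring_rule] compares values of [f] only up to [n.+1], so comparing scores requires this
    bound. It holds because [a] is never ahead of itself. *)
Lemma rank_le (c' : 'I_n.+1 -> 'rV[R]_d) x a : (rank c' x a <= n.+1)%N.
Proof.
rewrite /rank -[X in (_ <= X)%N]card_ord; apply/proper_card/properP.
split; first by apply/fintype.subsetP.
by exists a => //; rewrite !inE /ahead eqxx.
Qed.

Definition wins (x : 'rV[R]_d) : Prop :=
  forall a, score f (moved c x) v a <= score f (moved c x) v ord0.

(** The order among rivals is unaffected by the move. The target stays ahead wherever it was, so no
    rival gains score and the target loses none. *)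
Lemma wins_mono x w : scoring_rule n.+1 f ->
  (forall j a, a != ord0 -> dist2 (v j) x <= dist2 (v j) (c a) ->
     dist2 (v j) w <= dist2 (v j) (c a)) ->
  wins x -> wins w.
Proof.
move=> fs xw winx a; have [->//|a0] := eqVneq a ord0.
apply: le_trans (_ : score f (moved c x) v a <= _).
  apply: ler_sum => j _; apply: fs; rewrite ?rank_le //.
  apply/subset_leq_card/fintype.subsetP => b; rewrite !inE /ahead /moved (negPf a0).
  case: (eqVneq b ord0) => //= -> /andP[-> /=].
  rewrite orbC -le_eqVlt => /xw h.
  by rewrite orbC -le_eqVlt h.
apply: le_trans (winx a) _.
apply: ler_sum => j _; apply: fs; rewrite ?rank_le //.
apply/subset_leq_card/fintype.subsetP => b; rewrite !inE /ahead /moved eqxx.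
case: (eqVneq b ord0) => //= b0; rewrite !orbF => h.
by rewrite ltNge; apply/negP => /(xw j b b0); rewrite leNgt h.
Qed.

End Election.

(** * A program logic for the real RAM *)

(* A code fragment is parametrized by the address at which it is placed. *)
Definition frag := nat -> seq instr.

Definition emit (i : instr) : frag := fun=> [:: i].
Definition skip : frag := fun=> [::].
Definition fseq (g1 g2 : frag) : frag :=
  fun l => let c1 := g1 l in c1 ++ g2 (l + size c1)%N.
Notation "g1 ;; g2" := (fseq g1 g2) (at level 61, right associativity).

(** Register numbers are fixed inside instructions, so a loop over coordinates is expanded when the
    program is generated; [d] is constant. *)
Fixpoint unroll (k : nat) (F : nat -> frag) : frag :=
  if k is k'.+1 then unroll k' F ;; F k' else skip.

(** The code for the false case comes first and is skipped by the jump. Addresses are computed from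
    code already placed, so nothing has to be known about how sizes depend on addresses. *)
Definition branch (J : nat -> instr) (g1 g2 : frag) : frag := fun l =>
  let c2 := g2 l.+1 in
  let l1 := (l.+1 + size c2).+1 in
  let c1 := g1 l1 in
  J l1 :: c2 ++ Jump (l1 + size c1) :: c1.

(* [r] runs from [0] below the content of [lim]; the body must preserve both
   registers, and [r.+1] is overwritten. *)
Definition for_loop (r lim : nat) (body : frag) : frag := fun l =>
  let c := body l.+2 in
  [:: NConst r 0; NJumpLe lim r (l.+2 + size c + 3)%N] ++ c ++
  [:: NConst r.+1 1; NAdd r r r.+1; Jump l.+1].

Definition not_halt (i : instr) : bool := if i is Halt _ then false else true.

Section WP.
Variables (R : realType) (M : nat -> R).
Implicit Types (N : nat -> nat) (X : nat -> R) (g : frag)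
  (Q : (nat -> nat) -> (nat -> R) -> Prop).

(** Quantifying over the remaining fuel makes executions compose by adding their step counts. *)
Definition reach (P : seq instr) (t : nat) (s s' : state R) : Prop :=
  forall t', run P (t + t') s = run P t' s'.

Lemma reach_trans P t1 t2 s1 s2 s3 :
  reach P t1 s1 s2 -> reach P t2 s2 s3 -> reach P (t1 + t2) s1 s3.
Proof. by move=> h1 h2 t; rewrite -addnA h1 h2. Qed.

Definition code_at (P : seq instr) (l : nat) (c : seq instr) : Prop :=
  exists p q, P = p ++ c ++ q /\ size p = l.

Lemma code_at_cat P l c1 c2 : code_at P l (c1 ++ c2) ->
  code_at P l c1 /\ code_at P (l + size c1) c2.
Proof.
move=> [p [q [-> <-]]]; split; first by exists p, (c2 ++ q); rewrite -!catA.
by exists (p ++ c1), q; rewrite size_cat -!catA.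
Qed.

Lemma code_at_cons P l i c : code_at P l (i :: c) ->
  code_at P l [:: i] /\ code_at P l.+1 c.
Proof. by rewrite -cat1s => /code_at_cat; rewrite addn1. Qed.

Lemma reach_step P i s : not_halt i -> code_at P (pc s) [:: i] ->
  reach P 1 s (step i s).
Proof.
move=> ni [p [q [-> sp]]] t /=.
rewrite map_cat nth_cat size_map sp ltnn subnn /=.
by case: i ni.
Qed.

(* The memories are not among the variables of the logic: no program fragment
   below writes to them. *)
Definition wp g (T : nat) N X Q : Prop :=
  forall P l NM, code_at P l (g l) ->
  exists t N' X', [/\ (t <= T)%N,
    reach P t (State l N NM X M) (State (l + size (g l)) N' NM X' M)
    & Q N' X'].

Lemma wp_weaken g T T' N X Q Q' : (T <= T')%N ->
  (forall N' X', Q N' X' -> Q' N' X') -> wp g T N X Q -> wp g T' N X Q'.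
Proof.
move=> TT' QQ' h P l NM cP; have [t [N' [X' [tT r q]]]] := h P l NM cP.
by exists t, N', X'; split; [exact: leq_trans TT'| |exact: QQ'].
Qed.

Lemma wp_time g T T' N X Q : (T <= T')%N -> wp g T N X Q -> wp g T' N X Q.
Proof. by move=> h; exact: wp_weaken. Qed.

Lemma wp_skip N X Q : Q N X -> wp skip 0 N X Q.
Proof. by move=> q P l NM _; exists 0%N, N, X; split; rewrite ?addn0. Qed.

Lemma wp_seq g1 g2 T1 T2 N X Q :
  wp g1 T1 N X (fun N' X' => wp g2 T2 N' X' Q) ->
  wp (g1 ;; g2) (T1 + T2) N X Q.
Proof.
move=> h P l NM /code_at_cat[cP1 cP2].
have [t1 [N1 [X1 [tT1 r1 h2]]]] := h P l NM cP1.
have [t2 [N2 [X2 [tT2 r2 q]]]] := h2 P _ NM cP2.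
exists (t1 + t2)%N, N2, X2; split=> //; first exact: leq_add.
by rewrite size_cat addnA; exact: reach_trans r2.
Qed.

Lemma wp_emit i N X N' X' Q : not_halt i ->
  (forall l NM, step i (State l N NM X M) = State l.+1 N' NM X' M) ->
  Q N' X' -> wp (emit i) 1 N X Q.
Proof.
move=> ni si q P l NM cP; exists 1%N, N', X'; split=> //.
by rewrite addn1 -si; exact: reach_step.
Qed.

Lemma wp_unroll k F T N X Q (I : nat -> (nat -> nat) -> (nat -> R) -> Prop) :
  I 0%N N X ->
  (forall i N' X', (i < k)%N -> I i N' X' -> wp (F i) T N' X' (I i.+1)) ->
  (forall N' X', I k N' X' -> Q N' X') ->
  wp (unroll k F) (k * T) N X Q.
Proof.
move=> I0 IS IQ; apply: (wp_weaken (leqnn _) IQ).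
elim: k IS {IQ} => [|k IH] IS; first exact: wp_skip.
rewrite mulSnr; apply: wp_seq.
apply: (wp_weaken (leqnn _) _ (IH (fun i N' X' ik => IS i N' X' (ltnW ik)))).
by move=> N' X'; exact: IS.
Qed.

Lemma wp_branch J g1 g2 T N X Q (b : bool) :
  (forall l, not_halt (J l)) ->
  (forall l l' NM, step (J l') (State l N NM X M) =
     State (if b then l' else l.+1) N NM X M) ->
  (b -> wp g1 T N X Q) -> (~~ b -> wp g2 T N X Q) ->
  wp (branch J g1 g2) (T + 2) N X Q.
Proof.
move=> nJ sJ h1 h2 P l NM.
rewrite /branch; set c2 := g2 l.+1; set l1 := (_ + _).+1.
set c1 := g1 l1 => /code_at_cons[cJ] /code_at_cat[cP2] /code_at_cons[cJ'].
have -> : (l.+1 + size c2).+1 = l1 by [].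
move=> cP1.
have rJ := @reach_step P (J l1) (State l N NM X M) (nJ _) cJ.
have szE : (l + size (J l1 :: c2 ++ Jump (l1 + size c1) :: c1) =
    l1 + size c1)%N by rewrite /= size_cat /= /l1; lia.
rewrite szE; rewrite sJ in rJ.
case: b sJ h1 h2 rJ => sJ h1 h2 rJ.
  have [t [N' [X' [tT r q]]]] := h1 isT P _ NM cP1.
  exists (1 + t)%N, N', X'; split=> //; first lia.
  exact: reach_trans r.
have [t [N' [X' [tT r q]]]] := h2 isT P _ NM cP2.
exists (1 + t + 1)%N, N', X'; split=> //; first lia.
apply: reach_trans (reach_trans rJ r) _.
by apply: (@reach_step P (Jump (l1 + size c1)) (State _ N' NM X' M)).
Qed.

(** The 2 pays for the initialization and the last test, the 4 for the test, the increment and the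
    jump back in each round. The invariant is required after the increment has overwritten [r] and
    [r.+1]. *)
Lemma wp_for r lim body T K N X Q
    (I : nat -> (nat -> nat) -> (nat -> R) -> Prop) :
  (lim < r)%N -> N lim = K ->
  I 0%N (upd N r 0%N) X ->
  (forall i N' X', (i < K)%N -> N' r = i -> N' lim = K -> I i N' X' ->
    wp body T N' X' (fun N'' X'' => [/\ N'' r = i, N'' lim = K &
      I i.+1 (upd (upd N'' r.+1 1%N) r i.+1) X''])) ->
  (forall N' X', I K N' X' -> Q N' X') ->
  wp (for_loop r lim body) (2 + K * (T + 4)) N X Q.
Proof.
move=> limr NK I0 IS IQ; apply: (wp_weaken (leqnn _) IQ).
move=> P l NM; rewrite /for_loop; set c := body l.+2; set e := (_ + 3)%N.
move=> /code_at_cons[c0] /code_at_cons[c1] /code_at_cat[cb].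
move=> /code_at_cons[c2] /code_at_cons[c3 c4].
have -> : (l + size ([:: NConst r 0, NJumpLe lim r e
    & c ++ [:: NConst r.+1 1; NAdd r r r.+1; Jump l.+1]]) = e)%N.
  by rewrite /= size_cat /= /e; lia.
(* Induction on the number [k] of remaining rounds, the counter being [K - k]. *)
have loop k : (k <= K)%N -> forall N' X', N' r = (K - k)%N -> N' lim = K ->
    I (K - k)%N N' X' -> exists t N'' X'', [/\ (t <= 1 + k * (T + 4))%N,
      reach P t (State l.+1 N' NM X' M) (State e N'' NM X'' M) & I K N'' X''].
  elim: k => [|k IH] kK N' X' Nr Nlim HI.
    exists 1%N, N', X'; split=> //; last by rewrite subn0 in HI.
    have := @reach_step P (NJumpLe lim r e) (State l.+1 N' NM X' M) isT c1.
    by rewrite /= Nr Nlim subn0 leqnn.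
  have iK : (K - k.+1 < K)%N by lia.
  have [t [N1 [X1 [tT r1 [N1r N1lim I1]]]]] :=
    IS _ N' X' iK Nr Nlim HI P _ NM cb.
  set N2 := upd _ r _ in I1.
  have eqi : (K - k.+1).+1 = (K - k)%N by lia.
  rewrite eqi in I1.
  have N2r : N2 r = (K - k)%N by rewrite /N2 /upd eqxx eqi.
  have N2lim : N2 lim = K.
    by rewrite /N2 /upd !ifF //; apply/eqP; lia.
  have [t' [N3 [X3 [t'T r3 I3]]]] := IH (ltnW kK) _ _ N2r N2lim I1.
  exists (1 + (t + (3 + t')))%N, N3, X3; split=> //; first lia.
  have rJ : reach P 1 (State l.+1 N' NM X' M) (State l.+2 N' NM X' M).
    have := @reach_step P (NJumpLe lim r e) (State l.+1 N' NM X' M) isT c1.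
    by rewrite /= Nr Nlim [X in if X then _ else _]leqNgt iK.
  apply: (reach_trans rJ); apply: (reach_trans r1); apply: reach_trans r3.
  rewrite -[3%N]/(1 + (1 + 1))%N.
  apply: (reach_trans (@reach_step P (NConst r.+1 1) (State _ N1 NM X1 M) isT c2)).
  apply: (reach_trans
    (@reach_step P (NAdd r r r.+1) (State _ (upd N1 r.+1 1%N) NM X1 M) isT c3)).
  have -> : N2 = upd (upd N1 r.+1 1%N) r
      ((upd N1 r.+1 1%N) r + (upd N1 r.+1 1%N) r.+1)%N.
    rewrite /N2; congr upd; rewrite /upd eqxx ifF ?N1r ?addn1 //.
    by apply/eqP; lia.
  exact: (@reach_step P (Jump l.+1) (State _ _ NM X1 M) isT c4).
have [|||t [N' [X' [tT rr HI]]]] := loop K (leqnn K) (upd N r 0%N) X.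
- by rewrite subnn /upd eqxx.
- by rewrite /upd ifF //; apply/eqP; lia.
- by rewrite subnn.
exists (1 + t)%N, N', X'; split=> //.
apply: reach_trans rr.
exact: (@reach_step P (NConst r 0) (State l N NM X M) isT c0).
Qed.

End WP.

(** * Compiling vector expressions *)

Inductive rop := OAdd | OSub | OMul | ODiv.
Inductive expr := EReg of nat | EZero | EOne | EOp of rop & expr & expr.

Definition rop_instr (o : rop) : nat -> nat -> nat -> instr :=
  match o with OAdd => RAdd | OSub => RSub | OMul => RMul | ODiv => RDiv end.

(* Evaluates [e] into register [r], with the registers above [r] as a stack. *)
Fixpoint compile (e : expr) (r : nat) : frag :=
  match e with
  | EReg i => emit (RZero r) ;; emit (RAdd r i r)
  | EZero => emit (RZero r)
  | EOne => emit (ROne r)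
  | EOp o a b => compile a r ;; compile b r.+1 ;; emit (rop_instr o r r r.+1)
  end.

Fixpoint etime (e : expr) : nat :=
  match e with
  | EReg _ => 1 + 1
  | EOp _ a b => etime a + (etime b + 1)
  | _ => 1
  end.

Fixpoint below (r : nat) (e : expr) : bool :=
  match e with
  | EReg i => i < r
  | EOp _ a b => below r a && below r b
  | _ => true
  end%N.

Lemma below_le r r' e : (r <= r')%N -> below r e -> below r' e.
Proof.
move=> rr'; elim: e => //= [i|o a IHa b IHb]; first by move/leq_trans; apply.
by move=> /andP[/IHa -> /IHb].
Qed.

Definition vexpr := nat -> expr.

Definition vreg (r : nat) : vexpr := fun k => EReg (r + k).
Definition vop (o : rop) (a b : vexpr) : vexpr := fun k => EOp o (a k) (b k).
Definition vscale (e : expr) (a : vexpr) : vexpr := fun k => EOp OMul e (a k).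
Definition vzero : vexpr := fun=> EZero.

Section VectorExpressions.
Variable d : nat.

Definition edot (a b : vexpr) : expr :=
  foldr (fun k e => EOp OAdd (EOp OMul (a k) (b k)) e) EZero (iota 0 d).
Definition edist2 (a b : vexpr) : expr :=
  edot (vop OSub a b) (vop OSub a b).
Definition epower (B : vexpr * expr) (x : vexpr) : expr :=
  EOp OSub (edist2 x B.1) B.2.
Definition egs_dir (us : seq vexpr) (e : vexpr) : vexpr :=
  vop OSub e (foldr (fun u s => vop OAdd
    (vscale (EOp ODiv (edot e u) (edot u u)) u) s) vzero us).
Definition egs_step (B0 : vexpr * expr) (st : seq vexpr * vexpr)
    (B : vexpr * expr) : seq vexpr * vexpr :=
  let u := egs_dir st.1 (vop OSub B.1 B0.1) in
  (u :: st.1, vop OAdd st.2 (vscale (EOp ODiv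
     (EOp OSub (epower B st.2) (epower B0 st.2))
     (EOp OMul (EOp OAdd EOne EOne) (edot u u))) u)).
(** The whole computation becomes one straight-line expression per coordinate. Subexpressions are
    duplicated, but the size depends on [d] and the number of balls only. *)
Definition eradical_center B0 Bs : vexpr :=
  (foldl (egs_step B0) ([::], B0.1) Bs).2.

Definition vbelow (r : nat) (a : vexpr) : Prop :=
  forall k, (k < d)%N -> below r (a k).

Lemma below_edot r a b : vbelow r a -> vbelow r b -> below r (edot a b).
Proof.
move=> ha hb; rewrite /edot.
have : all (fun k => k < d)%N (iota 0 d) by apply/allP => k; rewrite mem_iota.
by elim: (iota 0 d) => //= k s IH /andP[kd /IH ->]; rewrite ha ?hb.
Qed.

Lemma vbelow_vop r o a b : vbelow r a -> vbelow r b -> vbelow r (vop o a b).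
Proof. by move=> ha hb k kd /=; rewrite ha ?hb. Qed.

Lemma vbelow_vscale r e a : below r e -> vbelow r a -> vbelow r (vscale e a).
Proof. by move=> he ha k kd /=; rewrite he ha. Qed.

Lemma vbelow_vreg r i : (i + d <= r)%N -> vbelow r (vreg i).
Proof. by move=> ir k kd /=; lia. Qed.

Lemma below_edist2 r a b : vbelow r a -> vbelow r b -> below r (edist2 a b).
Proof. by move=> ha hb; apply: below_edot; apply: vbelow_vop. Qed.

Lemma below_epower r B x : vbelow r B.1 -> below r B.2 -> vbelow r x ->
  below r (epower B x).
Proof. by move=> h1 h2 h3 /=; rewrite below_edist2. Qed.

(** Vector expressions are functions without decidable equality, hence [List.In]. *)
Lemma vbelow_eradical_center r B0 Bs : vbelow r B0.1 -> below r B0.2 ->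
  (forall B, List.In B Bs -> vbelow r B.1 /\ below r B.2) ->
  vbelow r (eradical_center B0 Bs).
Proof.
move=> h01 h02 hB; rewrite /eradical_center.
pose ok (st : seq vexpr * vexpr) :=
  (forall u, List.In u st.1 -> vbelow r u) /\ vbelow r st.2.
suff : ok (foldl (egs_step B0) ([::], B0.1) Bs) by case.
have : ok ([::], B0.1) by split.
elim: Bs ([::], B0.1) hB => //= B Bs IH [us w] hB [/= hus hw].
have [hB1 hB2] := hB B (or_introl erefl).
apply: IH => [B' h|]; first by apply: hB; right.
have hu : vbelow r (egs_dir us (vop OSub B.1 B0.1)).
  apply: vbelow_vop; first exact: vbelow_vop.
  elim: us hus => //= u us IH hus.
  have hu : vbelow r u by apply: hus; left.
  apply: vbelow_vop; last by apply: IH => u' h; apply: hus; right.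
  apply: vbelow_vscale => //=.
  by rewrite !below_edot //; exact: vbelow_vop.
split=> [u /= [<-//|]|]; first exact: hus.
apply: vbelow_vop => //; apply: vbelow_vscale => //.
have hP := below_epower hB1 hB2 hw; have hP0 := below_epower h01 h02 hw.
by rewrite /= in hP hP0; rewrite /= hP hP0 below_edot.
Qed.

Variable R : realType.
Implicit Types X : nat -> R.

Definition rop_fun (o : rop) (x y : R) : R :=
  match o with OAdd => x + y | OSub => x - y | OMul => x * y | ODiv => x / y end.

Fixpoint evale X (e : expr) : R :=
  match e with
  | EReg i => X i
  | EZero => 0
  | EOne => 1
  | EOp o a b => rop_fun o (evale X a) (evale X b)
  end.

Definition veval X (a : vexpr) : 'rV[R]_d := \row_(k < d) evale X (a k).

Lemma eval_ext r X X' e : below r e -> (forall i, (i < r)%N -> X' i = X i) ->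
  evale X' e = evale X e.
Proof.
move=> be h; elim: e be => //= o a IHa b IHb.
by move=> /andP[/IHa -> /IHb ->].
Qed.

Lemma veval_ext r X X' a : vbelow r a -> (forall i, (i < r)%N -> X' i = X i) ->
  veval X' a = veval X a.
Proof.
by move=> ba h; apply/rowP => k; rewrite !mxE; apply: eval_ext h; exact: ba.
Qed.

Lemma eval_edot X a b : evale X (edot a b) = dotv (veval X a) (veval X b).
Proof.
rewrite /dotv; under eq_bigr do rewrite !mxE.
rewrite -(big_mkord xpredT (fun k => evale X (a k) * evale X (b k))).
rewrite /index_iota subn0 /edot.
by elim: (iota 0 d) => /= [|k s ->]; rewrite ?big_nil ?big_cons.
Qed.

Lemma veval_add X a b : veval X (vop OAdd a b) = veval X a + veval X b.
Proof. by apply/rowP => k; rewrite !mxE. Qed.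

Lemma veval_sub X a b : veval X (vop OSub a b) = veval X a - veval X b.
Proof. by apply/rowP => k; rewrite !mxE. Qed.

Lemma veval_scale X e a : veval X (vscale e a) = evale X e *: veval X a.
Proof. by apply/rowP => k; rewrite !mxE. Qed.

Lemma eval_edist2 X a b : evale X (edist2 a b) = dist2 (veval X a) (veval X b).
Proof. by rewrite eval_edot veval_sub dist2E. Qed.

Definition beval X (B : vexpr * expr) := (veval X B.1, evale X B.2).

Lemma veval_eradical_center X B0 Bs :
  veval X (eradical_center B0 Bs) =
  radical_center (beval X B0) [seq beval X B | B <- Bs].
Proof.
rewrite /eradical_center /radical_center.
suff gen us us' w w' : map (veval X) us' = us -> veval X w' = w ->
    veval X (foldl (egs_step B0) (us', w') Bs).2 =
    (foldl (gs_step (beval X B0)) (us, w) [seq beval X B | B <- Bs]).2.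
  exact: gen.
elim: Bs us us' w w' => //= B Bs IH us us' w w' eus ew.
have eu : veval X (egs_dir us' (vop OSub B.1 B0.1)) =
    gs_dir us (veval X B.1 - veval X B0.1).
  rewrite veval_sub /gs_dir veval_sub; congr (_ - _); rewrite -eus.
  elim: us' {eus} => [|u us' IHu] /=.
    by rewrite big_nil; apply/rowP => k; rewrite !mxE.
  by rewrite veval_add veval_scale IHu big_cons /= !eval_edot veval_sub.
rewrite /gs_step /egs_step /=; apply: IH; first by rewrite /= eu eus.
by rewrite veval_add veval_scale /= ew eu !(eval_edist2 _ w') eval_edot eu ew.
Qed.

End VectorExpressions.

(** * The search *)

(* Register discipline: a fragment with bases [nb] and [xb] reads its arguments
   below these bases and puts its results and scratch data above them. *)
Definition keep (R : realType) (nb xb : nat) (N : nat -> nat) (X : nat -> R)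
    (N' : nat -> nat) (X' : nat -> R) : Prop :=
  (forall i, (i < nb)%N -> N' i = N i) /\ (forall i, (i < xb)%N -> X' i = X i).

Section Keep.
Variables (R : realType).
Implicit Types (N : nat -> nat) (X : nat -> R).

Lemma keep_trans nb xb nb' xb' N X N1 X1 N2 X2 :
  (nb <= nb')%N -> (xb <= xb')%N ->
  keep nb xb N X N1 X1 -> keep nb' xb' N1 X1 N2 X2 -> keep nb xb N X N2 X2.
Proof.
move=> nn xx [k1 l1] [k2 l2]; split=> i ib.
  by rewrite k2 ?k1 // (leq_trans ib).
by rewrite l2 ?l1 // (leq_trans ib).
Qed.

Lemma keep_updN nb xb N X N' X' r k : (nb <= r)%N ->
  keep nb xb N X N' X' -> keep nb xb N X (upd N' r k) X'.
Proof.
move=> nr [k1 l1]; split=> // i ib.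
by rewrite /upd ifF ?k1 //; apply/eqP; lia.
Qed.

Lemma keep_updX nb xb N X N' X' r x : (xb <= r)%N ->
  keep nb xb N X N' X' -> keep nb xb N X N' (upd X' r x).
Proof.
move=> nr [k1 l1]; split=> // i ib.
by rewrite /upd ifF ?l1 //; apply/eqP; lia.
Qed.

Lemma updxx (T : Type) (g : nat -> T) i x : upd g i x i = x.
Proof. by rewrite /upd eqxx. Qed.

Lemma upd_neq (T : Type) (g : nat -> T) i j x : (j < i)%N || (i < j)%N ->
  upd g i x j = g j.
Proof. by move=> h; rewrite /upd ifF //; apply/eqP; lia. Qed.

End Keep.

(** * Loading points, ranking, scoring, testing and enumerating tuples *)

Section Fragments.
Variables (d : nat) (R : realType) (M : nat -> R).
Implicit Types (N : nat -> nat) (X : nat -> R)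
  (Q : (nat -> nat) -> (nat -> R) -> Prop).
Local Notation wp := (wp M).
Local Notation veval := (veval d).

Lemma wp_NConst r k N X Q : Q (upd N r k) X -> wp (emit (NConst r k)) 1 N X Q.
Proof. exact: wp_emit. Qed.

Lemma wp_NAdd r a b N X Q :
  Q (upd N r (N a + N b)%N) X -> wp (emit (NAdd r a b)) 1 N X Q.
Proof. exact: wp_emit. Qed.

Lemma wp_RLoad r a N X Q :
  Q N (upd X r (M (N a))) -> wp (emit (RLoad r a)) 1 N X Q.
Proof. exact: wp_emit. Qed.

Lemma wp_RZero r N X Q : Q N (upd X r 0) -> wp (emit (RZero r)) 1 N X Q.
Proof. exact: wp_emit. Qed.

Lemma wp_ROne r N X Q : Q N (upd X r 1) -> wp (emit (ROne r)) 1 N X Q.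
Proof. exact: wp_emit. Qed.

Lemma wp_RAdd r a b N X Q :
  Q N (upd X r (X a + X b)) -> wp (emit (RAdd r a b)) 1 N X Q.
Proof. exact: wp_emit. Qed.

Lemma wp_RMul r a b N X Q :
  Q N (upd X r (X a * X b)) -> wp (emit (RMul r a b)) 1 N X Q.
Proof. exact: wp_emit. Qed.

Lemma wp_rop o r a b N X Q : Q N (upd X r (rop_fun o (X a) (X b))) ->
  wp (emit (rop_instr o r a b)) 1 N X Q.
Proof. by case: o => h; exact: wp_emit h. Qed.

Lemma wp_ifNle a b g1 g2 T N X Q :
  ((N a <= N b)%N -> wp g1 T N X Q) -> ((N b < N a)%N -> wp g2 T N X Q) ->
  wp (branch (NJumpLe a b) g1 g2) (T + 2) N X Q.
Proof.
move=> h1 h2; apply: (wp_branch (b := (N a <= N b)%N)) => // h.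
by apply: h2; rewrite ltnNge.
Qed.

Lemma wp_ifRle a b g1 g2 T N X Q :
  (X a <= X b -> wp g1 T N X Q) -> (X b < X a -> wp g2 T N X Q) ->
  wp (branch (RJumpLe a b) g1 g2) (T + 2) N X Q.
Proof.
move=> h1 h2; apply: (wp_branch (b := (X a <= X b))) => // h.
by apply: h2; rewrite ltNge.
Qed.

Lemma wp_ifRlt a b g1 g2 T N X Q :
  (X a < X b -> wp g1 T N X Q) -> (X b <= X a -> wp g2 T N X Q) ->
  wp (branch (RJumpLt a b) g1 g2) (T + 2) N X Q.
Proof.
move=> h1 h2; apply: (wp_branch (b := (X a < X b))) => // h.
by apply: h2; rewrite leNgt.
Qed.

(** [below r e] keeps the operands clear of the stack. In particular a register is copied by
    clearing [r] and adding, which would destroy a source equal to [r]. *)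
Lemma wp_compile e r N X Q : below r e ->
  (forall X', X' r = evale X e -> keep 0 r N X N X' -> Q N X') ->
  wp (compile e r) (etime e) N X Q.
Proof.
elim: e r N X Q => [i|||o a IHa b IHb] r N X Q /= be h.
- apply/wp_seq/wp_RZero/wp_RAdd; apply: h.
    by rewrite /= updxx upd_neq ?be // updxx addr0.
  by do 2!apply: keep_updX => //.
- by apply: wp_RZero; apply: h; [rewrite updxx | exact: keep_updX].
- by apply: wp_ROne; apply: h; [rewrite updxx | exact: keep_updX].
move: be => /andP[ba bb]; apply/wp_seq/IHa => // X1 e1 k1.
apply/wp_seq/IHb; first exact: below_le bb.
move=> X2 e2 k2; apply: wp_rop; apply: h.
  rewrite updxx e2 (proj2 k2) // e1; congr rop_fun.
  by apply: eval_ext bb _; exact: (proj2 k1).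
by apply: keep_updX => //; exact: (keep_trans _ _ k1 k2).
Qed.

Definition assignv (r : nat) (a : vexpr) : frag :=
  unroll d (fun k => compile (a k) (r + k)).

Definition vtime (a : vexpr) : nat := (d * \max_(k < d) etime (a k))%N.

(** Coordinate [k] uses a stack based at [r + k], so its scratch data only overwrite places of
    coordinates still to be computed. *)
Lemma wp_assignv r a N X Q : vbelow d r a ->
  (forall X', veval X' (vreg r) = veval X a -> keep 0 r N X N X' -> Q N X') ->
  wp (assignv r a) (vtime a) N X Q.
Proof.
move=> ba h.
pose I i N' X' := [/\ N' = N, keep 0 r N X N X' &
  forall k, (k < i)%N -> X' (r + k)%N = evale X (a k)].
apply: (@wp_unroll _ _ _ _ _ _ _ _ I) => //; last first.
  move=> N' X' [-> k1 e1]; apply: h => //.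
  by apply/rowP => k; rewrite !mxE /= e1.
move=> i N' X' id [-> k1 e1].
apply: (wp_time (T := etime (a i))).
  exact: (leq_bigmax (F := fun k : 'I_d => etime (a k)) (Ordinal id)).
apply: wp_compile; first by apply: below_le (ba _ id); lia.
move=> X2 e2 k2; split=> //.
  by apply: (keep_trans _ _ k1 k2) => //; lia.
move=> k; rewrite ltnS leq_eqVlt => /orP[/eqP ->|ki].
  by rewrite e2; apply: eval_ext (ba _ id) _; exact: (proj2 k1).
by rewrite (proj2 k2) ?e1 // ltn_add2l.
Qed.

(** Candidates and voters are adjacent in memory, so one index covers both: voter [j] is point
    [Nc + j]. *)
Definition mem_point (i : nat) : 'rV[R]_d := \row_(k < d) M (i * d + k)%N.

(** Natural registers have no multiplication; the address [d * N p] is obtained by [d] additions. *)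
Definition load_point (p r nb : nat) : frag :=
  emit (NConst nb 0) ;; unroll d (fun=> emit (NAdd nb nb p)) ;;
  emit (NConst nb.+1 1) ;;
  unroll d (fun k => emit (RLoad (r + k) nb) ;; emit (NAdd nb nb nb.+1)).

Definition load_time : nat := (1 + (d * 1 + (1 + d * (1 + 1))))%N.

Lemma wp_load_point p r nb N X Q : (p < nb)%N ->
  (forall N' X', keep nb r N X N' X' -> veval X' (vreg r) = mem_point (N p) ->
     Q N' X') ->
  wp (load_point p r nb) load_time N X Q.
Proof.
move=> pnb h; apply/wp_seq/wp_NConst/wp_seq.
apply: (@wp_unroll _ _ _ _ _ _ _ _ (fun i N' X' =>
  [/\ keep nb r N X N' X' & N' nb = i * N p])%N).
- by split; rewrite ?updxx //; exact: keep_updN.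
- move=> i N' X' _ [k1 e1]; apply: wp_NAdd; split; first exact: keep_updN.
  by rewrite updxx e1 (proj1 k1) // mulSnr.
move=> N1 X1 [k1 e1]; apply/wp_seq/wp_NConst.
apply: (@wp_unroll _ _ _ _ _ _ _ _ (fun i N' X' =>
  [/\ keep nb r N X N' X', N' nb = d * N p + i, N' nb.+1 = 1 &
   forall k, k < i -> X' (r + k) = M (N p * d + k)])%N).
- split; rewrite ?updxx //; first by apply: keep_updN; rewrite // leqW.
  by rewrite upd_neq ?e1 ?addn0 // leqnn.
- move=> i N' X' id [k2 e2 o2 l2]; apply/wp_seq/wp_RLoad/wp_NAdd; split.
  + by apply: keep_updN => //; apply: keep_updX k2; lia.
  + by rewrite updxx e2 o2; lia.
  + by rewrite upd_neq // leqnn orbT.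
  move=> k; rewrite ltnS leq_eqVlt => /orP[/eqP ->|ki].
    by rewrite updxx e2 mulnC.
  by rewrite upd_neq ?l2 // ltn_add2l ki.
move=> N2 X2 [k2 _ _ l2]; apply: h => //.
by apply/rowP => k; rewrite !mxE /= l2.
Qed.

Variables (Nc m : nat).

(* Natural register 5 holds the answer, real registers [0 .. d] hold the original
   position of the target and [eps ^+ 2] (see [rconsts]), and the [d + 1] registers
   from [j.+1 * d.+1] on hold the center and squared radius of the [j]-th ball of
   the current tuple (see [bexpr]). *)
Definition consts N : Prop :=
  [/\ N 0 = Nc, N 1 = m, N 2 = Nc + m, N 3 = 0 & N 4 = (Nc + m) * d]%N.

Lemma keep_consts nb xb N X N' X' : (4 < nb)%N -> keep nb xb N X N' X' ->
  consts N -> consts N'.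
Proof.
move=> nb4 [k _] [n0 n1 n2 n3 n4]; rewrite /consts !k ?n0 ?n1 ?n2 ?n3 ?n4 //; lia.
Qed.

Lemma keep_veval nb xb N X N' X' r : (r + d <= xb)%N -> keep nb xb N X N' X' ->
  veval X' (vreg r) = veval X (vreg r).
Proof.
by move=> rx [_ k]; apply: (veval_ext (r := xb)) => //; exact: vbelow_vreg.
Qed.

Definition moved_point (ct : 'rV[R]_d) (i : nat) : 'rV[R]_d :=
  if i == 0%N then ct else mem_point i.

(** Register 3 holds 0, so the jump asks whether [b] is the target, whose tentative position is in
    registers at [ctb] and not in memory. *)
Definition load_cand (b ctb r nb : nat) : frag :=
  branch (NJumpLe b 3) (assignv r (vreg ctb)) (load_point b r nb).

Definition cand_time : nat := (vtime (vreg 0) + load_time + 2)%N.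

Lemma wp_load_cand b ctb r nb N X Q :
  (b < nb)%N -> (4 < nb)%N -> (ctb + d <= r)%N -> consts N ->
  (forall N' X', keep nb r N X N' X' ->
     veval X' (vreg r) = moved_point (veval X (vreg ctb)) (N b) -> Q N' X') ->
  wp (load_cand b ctb r nb) cand_time N X Q.
Proof.
move=> bnb nb4 cr [_ _ _ n3 _] h; apply: wp_ifNle; rewrite n3 => hb.
  apply: (wp_time (leq_addr _ _)).
  apply: wp_assignv; first exact: vbelow_vreg.
  move=> X' e1 k1; apply: h; first by split=> // i /(proj2 k1).
  by rewrite e1 /moved_point -leqn0 hb.
apply: (wp_time (leq_addl _ _)).
apply: wp_load_point => // N' X' k1 e1; apply: h => //.
by rewrite e1 /moved_point -leqn0 leqNgt hb.
Qed.

Definition incr (r t : nat) : frag := emit (NConst t 1) ;; emit (NAdd r r t).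

Lemma wp_incr r t N X Q : (r < t)%N ->
  (forall N', N' r = (N r).+1 ->
     (forall i, (i < t)%N -> i != r -> N' i = N i) -> Q N' X) ->
  wp (incr r t) 2 N X Q.
Proof.
move=> rt h; apply: (@wp_seq _ _ _ _ 1 1); apply/wp_NConst/wp_NAdd; apply: h.
  by rewrite !updxx upd_neq ?rt // addn1.
by move=> i it ir; rewrite !upd_neq // ?it //; lia.
Qed.

Definition count_ahead (y z a b r t : nat) : frag :=
  branch (RJumpLt y z) (incr r t)
    (branch (NJumpLe b 3)
       (branch (NJumpLe a 3) skip (branch (RJumpLe y z) (incr r t) skip))
       skip).

Lemma wp_count_ahead y z a b r t N X Q : (r < t)%N -> N 3%N = 0%N ->
  (forall N', N' r = (N r + ((X y < X z)%R ||
       [&& N b == 0%N, N a != 0%N & (X y <= X z)%R]))%N ->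
     (forall i, (i < t)%N -> i != r -> N' i = N i) -> Q N' X) ->
  wp (count_ahead y z a b r t) 10 N X Q.
Proof.
move=> rt n3 h.
have noinc T (hb : ((X y < X z) ||
    [&& N b == 0%N, N a != 0%N & X y <= X z]) = false) : wp skip T N X Q.
  apply: (@wp_time _ _ _ 0) => //; apply: wp_skip; apply: h => //.
  by rewrite hb addn0.
have inc T (hb : (X y < X z) ||
    [&& N b == 0%N, N a != 0%N & X y <= X z]) : (2 <= T)%N -> wp (incr r t) T N X Q.
  move=> T2; apply: (wp_time T2); apply: wp_incr => // N' e1 k1; apply: h => //.
  by rewrite e1 hb addn1.
apply: (@wp_ifRlt _ _ _ _ 8) => hyz; first by apply: inc; rewrite // hyz.
rewrite ltNge hyz /= in inc noinc.
apply: (@wp_ifNle _ _ _ _ 6); rewrite n3 => hb; last first.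
  by apply: noinc; rewrite -leqn0 leqNgt hb.
rewrite -[N b == _]leqn0 hb /= in inc noinc.
apply: (@wp_ifNle _ _ _ _ 4); rewrite n3 => ha.
  by apply: noinc; rewrite -leqn0 ha.
rewrite -[N a == _]leqn0 -ltnNge ha /= in inc noinc.
apply: (@wp_ifRle _ _ _ _ 2) => hzy; first exact: inc.
by apply: noinc; rewrite leNgt hzy.
Qed.

(** The condition [a != 0] replaces [b != a]: they agree when [b = 0], and a strict comparison
    excludes [b = a] by itself. Once the strict test fails, [<=] means equality, which matches the
    order of tests in [count_ahead]. *)
Definition aheadn (ct x : 'rV[R]_d) (b a : nat) : bool :=
  (dist2 x (moved_point ct b) < dist2 x (moved_point ct a)) ||
  [&& b == 0, a != 0 &
      (dist2 x (moved_point ct b) <= dist2 x (moved_point ct a))%R]%N.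

(** Counted from 0, hence directly the offset into the table of scores. *)
Definition rankn (ct x : 'rV[R]_d) (a : nat) : nat :=
  (\sum_(0 <= b < Nc) aheadn ct x b a)%N.

(** Layout: [nb] is the count and [nb.+1] the rival; candidate [a] is at [xb], its distance at
    [xb + d], and the rival's point and distance follow. *)
Definition rank_frag (a ctb vb nb xb : nat) : frag :=
  load_cand a ctb xb nb ;;
  compile (edist2 d (vreg vb) (vreg xb)) (xb + d) ;;
  emit (NConst nb 0) ;;
  for_loop nb.+1 0
    (load_cand nb.+1 ctb (xb + d).+1 nb.+3 ;;
     compile (edist2 d (vreg vb) (vreg (xb + d).+1)) ((xb + d).+1 + d) ;;
     count_ahead ((xb + d).+1 + d) (xb + d) a nb.+1 nb nb.+3).

Definition dist_time : nat := etime (edist2 d (vreg 0) (vreg 0)).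

Lemma etime_edist2 i j : etime (edist2 d (vreg i) (vreg j)) = dist_time.
Proof. by rewrite /dist_time /edist2 /edot; elim: (iota 0 d) => //= k s ->. Qed.

Lemma wp_dist i j r N X Q : (i + d <= r)%N -> (j + d <= r)%N ->
  (forall X', X' r = dist2 (veval X (vreg i)) (veval X (vreg j)) ->
     keep 0 r N X N X' -> Q N X') ->
  wp (compile (edist2 d (vreg i) (vreg j)) r) dist_time N X Q.
Proof.
move=> ir jr h; rewrite -(etime_edist2 i j); apply: wp_compile.
  by apply: below_edist2; exact: vbelow_vreg.
by move=> X' e k; apply: h; rewrite // -eval_edist2.
Qed.

Definition rank_time : nat :=
  (cand_time + (dist_time + (1 +
     (2 + Nc * (cand_time + (dist_time + 10) + 4)))))%N.

Lemma wp_rank_frag a ctb vb nb xb N X Q :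
  (a < nb)%N -> (4 < nb)%N -> (ctb + d <= xb)%N -> (vb + d <= xb)%N ->
  consts N ->
  (forall N' X', keep nb xb N X N' X' ->
     N' nb = rankn (veval X (vreg ctb)) (veval X (vreg vb)) (N a) -> Q N' X') ->
  wp (rank_frag a ctb vb nb xb) rank_time N X Q.
Proof.
move=> anb nb4 cx vx cN h.
set ct := veval X (vreg ctb) in h *; set x := veval X (vreg vb) in h *.
apply/wp_seq/wp_load_cand => // N1 X1 k1 e1; rewrite -/ct in e1.
apply: wp_seq; apply: wp_dist => //; first lia.
move=> X2 e2 k2; rewrite e1 (keep_veval vx k1) -/x in e2.
have k12 : keep nb xb N X N1 X2.
  by split=> i ib; [exact: (proj1 k1) | rewrite (proj2 k2) ?(proj2 k1) //; lia].
apply/wp_seq/wp_NConst.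
pose D := dist2 x (moved_point ct (N a)); rewrite -/D in e2.
apply: (@wp_for _ _ _ _ _ _ Nc _ _ _ (fun i N' X' => [/\ keep nb xb N X N' X',
    X' (xb + d)%N = D & N' nb = \sum_(0 <= b < i) aheadn ct x b (N a)]%N)) => //.
- rewrite upd_neq ?(proj1 k1) ?(let: And5 n0 _ _ _ _ := cN in n0) //; lia.
- split=> //; first by do 2!apply: keep_updN => //.
  by rewrite upd_neq ?updxx ?big_geq // ltnSn.
- move=> i N' X' iK Nr Nl [k3 e3 f3].
  have cN' : consts N' by exact: (keep_consts nb4 k3).
  have x' : veval X' (vreg vb) = x by exact: (keep_veval vx k3).
  have ct' : veval X' (vreg ctb) = ct by exact: (keep_veval cx k3).
  apply: wp_seq; apply: wp_load_cand; rewrite ?ltnSn //; try lia.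
  move=> N4 X4 k4; rewrite Nr ct' => e4.
  apply: wp_seq; apply: wp_dist => //; first lia.
  move=> X5 e5 k5; rewrite e4 in e5.
  rewrite (keep_veval _ k4) ?x' in e5; last lia.
  have nb7 : (4 < nb.+3)%N by lia.
  have [n0 n1 n2 n3 n4] := keep_consts nb7 k4 cN'.
  apply: wp_count_ahead; [lia | by [] |].
  rewrite e5 (proj2 k5) ?(proj2 k4) ?e3; try lia.
  have Na : N4 a = N a by rewrite (proj1 k4) ?(proj1 k3) //; lia.
  rewrite Na !(proj1 k4) ?Nr; try lia.
  move=> N6 e6 k6.
  have kk j : (j < nb.+3)%N -> j != nb -> N6 j = N' j.
    by move=> jn jnb; rewrite k6 // (proj1 k4).
  split.
  + by rewrite kk ?Nr //; lia.
  + by rewrite kk //; lia.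
  split.
  + do 2!(apply: keep_updN; first lia).
    split=> j jb.
      by rewrite kk ?(proj1 k3) //; lia.
    by rewrite (proj2 k5) ?(proj2 k4) ?(proj2 k3) //; lia.
  + by [].
  + rewrite !upd_neq ?leqnn //; last lia.
    by rewrite e6 f3 big_nat_recr.
- by move=> N' X' [k3 e3 f3]; apply: h.
Qed.

Definition scoren (ct : 'rV[R]_d) (a : nat) : R :=
  \sum_(0 <= j < m) M ((Nc + m) * d + rankn ct (mem_point (Nc + j)) a)%N.

(** The total is in [xb] and the voter at [xb.+1]. The operands [0] and [4] of [NAdd] are registers:
    the number of candidates and the base address of the table of scores. *)
Definition score_frag (a ctb nb xb : nat) : frag :=
  emit (RZero xb) ;;
  for_loop nb 1
    (emit (NAdd nb.+2 0 nb) ;;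
     load_point nb.+2 xb.+1 nb.+3 ;;
     rank_frag a ctb xb.+1 nb.+3 (xb.+1 + d) ;;
     emit (NAdd nb.+4 nb.+3 4) ;;
     emit (RLoad xb.+1 nb.+4) ;;
     emit (RAdd xb xb xb.+1)).

Definition score_time : nat :=
  (1 + (2 + m * (1 + (load_time + (rank_time + (1 + (1 + 1)))) + 4)))%N.

Lemma wp_score_frag a ctb nb xb N X Q :
  (a < nb)%N -> (4 < nb)%N -> (ctb + d <= xb)%N -> consts N ->
  (forall N' X', keep nb xb N X N' X' ->
     X' xb = scoren (veval X (vreg ctb)) (N a) -> Q N' X') ->
  wp (score_frag a ctb nb xb) score_time N X Q.
Proof.
move=> anb nb4 cx cN h; set ct := veval X (vreg ctb) in h *.
apply/wp_seq/wp_RZero.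
apply: (@wp_for _ _ _ _ _ _ m _ _ _ (fun i N' X' => [/\ keep nb xb N X N' X' &
    X' xb = \sum_(0 <= j < i)
      M ((Nc + m) * d + rankn ct (mem_point (Nc + j)) (N a))%N])).
- lia.
- by case: cN.
- split; last by rewrite updxx big_geq.
  by apply: keep_updN => //; exact: keep_updX.
- move=> i N' X' iK Nr Nl [k1 e1].
  apply/wp_seq/wp_NAdd.
  set N2 := upd _ _ _.
  have k2 : keep nb.+2 xb.+1 N' X' N2 X' by exact: keep_updN.
  have cN' : consts N' by exact: (keep_consts nb4 k1).
  have N2v : N2 nb.+2 = (Nc + i)%N by rewrite /N2 updxx Nr; case: cN' => ->.
  apply/wp_seq/wp_load_point; first by lia.
  rewrite N2v => N3 X3 k3 e3.
  have {k2} k3 : keep nb.+2 xb.+1 N' X' N3 X3 by apply: (keep_trans _ _ k2 k3); lia.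
  have cN3 : consts N3 by apply: (keep_consts _ k3 cN'); lia.
  apply/wp_seq/wp_rank_frag => //; try lia.
  rewrite e3 (keep_veval _ k3) ?(keep_veval cx k1) -/ct; last lia.
  rewrite (proj1 k3) ?(proj1 k1) //; last lia.
  move=> N4 X4 k4 e4.
  have {k3} k4 : keep nb.+2 xb.+1 N' X' N4 X4 by apply: (keep_trans _ _ k3 k4); lia.
  have [_ _ _ _ n4] : consts N4 by apply: (keep_consts _ k4 cN'); lia.
  apply/wp_seq/wp_NAdd/wp_seq/wp_RLoad/wp_RAdd.
  rewrite !updxx e4 n4; split.
  + by rewrite upd_neq ?(proj1 k4) //; lia.
  + by rewrite upd_neq ?(proj1 k4) //; lia.
  split.
  + do 3!(apply: keep_updN; first lia); do 2!(apply: keep_updX; first lia).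
    by apply: (keep_trans _ _ k1 k4); lia.
  + rewrite upd_neq ?ltnSn // (proj2 k4) // e1 big_nat_recr //=.
    by rewrite (addnC (rankn _ _ _)).
- by move=> N' X' [k1 e1]; exact: h.
Qed.

Variable eps2 : R.

Definition rconsts X : Prop := veval X (vreg 0) = mem_point 0 /\ X d = eps2.

Lemma keep_rconsts nb xb N X N' X' : (d < xb)%N -> keep nb xb N X N' X' ->
  rconsts X -> rconsts X'.
Proof.
move=> dx k [h1 h2]; split; first by rewrite (keep_veval _ k) // ltnW.
by rewrite (proj2 k).
Qed.

Definition test (ct : 'rV[R]_d) : bool :=
  (dist2 ct (mem_point 0) <= eps2) &&
  all (fun a => scoren ct a <= scoren ct 0) (iota 0 Nc).

(** The flag [nb] starts as the displacement test and is only ever cleared afterwards. Register 3,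
    holding 0, serves as the number of the target. *)
Definition test_frag (ctb nb xb : nat) : frag :=
  compile (edist2 d (vreg ctb) (vreg 0)) xb ;;
  branch (RJumpLe xb d) (emit (NConst nb 1)) (emit (NConst nb 0)) ;;
  score_frag 3 ctb nb.+1 xb ;;
  for_loop nb.+1 0
    (score_frag nb.+1 ctb nb.+3 xb.+1 ;;
     branch (RJumpLe xb.+1 xb) skip (emit (NConst nb 0))).

Definition test_time : nat :=
  (dist_time + (1 + 2 + (score_time +
    (2 + Nc * (score_time + (1 + 2) + 4)))))%N.

Lemma wp_test_frag ctb nb xb N X Q :
  (4 < nb)%N -> (ctb + d <= xb)%N -> (d < xb)%N -> consts N -> rconsts X ->
  (forall N' X', keep nb xb N X N' X' ->
     N' nb = test (veval X (vreg ctb)) -> Q N' X') ->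
  wp (test_frag ctb nb xb) test_time N X Q.
Proof.
move=> nb4 cx dx cN [x0 xd] h; set ct := veval X (vreg ctb) in h *.
apply: wp_seq; apply: wp_dist => //; first lia.
rewrite x0 -/ct => X1 e1 k1.
have {}k1 : keep nb xb N X N X1 by split=> // i /(proj2 k1).
have ct1 : veval X1 (vreg ctb) = ct by exact: (keep_veval cx k1).
have xd1 : X1 d = eps2 by rewrite (proj2 k1).
(* Both outcomes of the displacement test continue with the same code, treated once for either
   flag. *)
have next (b : bool) : (dist2 ct (mem_point 0) <= eps2) = b ->
  wp (score_frag 3 ctb nb.+1 xb ;; for_loop nb.+1 0
    (score_frag nb.+1 ctb nb.+3 xb.+1 ;;
     branch (RJumpLe xb.+1 xb) skip (emit (NConst nb 0))))
   (score_time + (2 + Nc * (score_time + (1 + 2) + 4)))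
   (upd N nb b) X1 Q.
  move=> be; set N1 := upd _ _ _.
  have kN1 : keep nb xb N X N1 X1 by exact: keep_updN.
  have cN1 : consts N1 by exact: (keep_consts nb4 kN1).
  apply: wp_seq; apply: wp_score_frag => //; try lia.
  rewrite ct1 => N2 X2 k2 e2.
  have n3 : N1 3%N = 0%N by case: cN1.
  rewrite n3 in e2.
  have k2' : keep nb xb N X N2 X2 by apply: (keep_trans _ _ kN1 k2).
  have cN2 : consts N2 by exact: (keep_consts nb4 k2').
  apply: (@wp_for _ _ _ _ _ _ Nc _ _ _ (fun i N' X' =>
    [/\ keep nb xb N X N' X', X' xb = scoren ct 0 & N' nb =
      (b && all (fun a => scoren ct a <= scoren ct 0)%R (iota 0 i)) :> nat])).
  - lia.
  - by case: cN2.
  - split=> //; first exact: keep_updN.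
    by rewrite upd_neq ?ltnSn // (proj1 k2) // /N1 updxx andbT.
  - move=> i N' X' iK Nr Nl [k3 e3 f3].
    have cN' : consts N' by exact: (keep_consts nb4 k3).
    apply: wp_seq; apply: wp_score_frag => //; try lia.
    rewrite Nr (keep_veval cx k3) -/ct => N4 X4 k4 e4.
    have X4b : X4 xb = scoren ct 0 by rewrite (proj2 k4).
    have k4' : keep nb xb N X N4 X4 by apply: (keep_trans _ _ k3 k4); lia.
    have allS : all (fun a => scoren ct a <= scoren ct 0)%R (iota 0 i.+1) =
        all (fun a => scoren ct a <= scoren ct 0)%R (iota 0 i) &&
        (scoren ct i <= scoren ct 0)%R.
      by rewrite -addn1 iotaD all_cat /= add0n andbT.
    apply: wp_ifRle; rewrite X4b e4 => hle.
      apply: (@wp_time _ _ _ 0) => //; apply: wp_skip; split.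
      + by rewrite (proj1 k4) //; lia.
      + by rewrite (proj1 k4) //; lia.
      split=> //; first by do 2!(apply: keep_updN; first lia).
      rewrite !upd_neq ?leqnn //; try lia.
      by rewrite (proj1 k4) ?f3 ?allS ?hle ?andbT //; lia.
    apply: wp_NConst; split.
    + by rewrite upd_neq ?(proj1 k4) //; lia.
    + by rewrite upd_neq ?(proj1 k4) //; lia.
    split=> //; first by do 3!(apply: keep_updN; first lia).
    do 2!(rewrite upd_neq; last lia).
    by rewrite updxx allS leNgt hle !andbF.
  - by move=> N' X' [k3 e3 f3]; apply: h; rewrite // f3 /test be.
apply/wp_seq/wp_ifRle; rewrite e1 xd1 => hle; apply: wp_NConst.
  exact: (next true).
by apply: (next false); rewrite leNgt hle.
Qed.

Definition mem_ball (q a : nat) : 'rV[R]_d * R :=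
  if a == 0%N then (mem_point 0, eps2)
  else (mem_point q, dist2 (mem_point q) (mem_point a)).

Definition load_ball (q a r nb : nat) : frag :=
  branch (NJumpLe a 3)
    (assignv r (vreg 0) ;; compile (EReg d) (r + d))
    (load_point q r nb ;; load_point a (r + d).+1 nb ;;
     compile (edist2 d (vreg r) (vreg (r + d).+1)) ((r + d).+1 + d) ;;
     emit (RZero (r + d)) ;; emit (RAdd (r + d) ((r + d).+1 + d) (r + d))).

Definition ball_time : nat :=
  (vtime (vreg 0) + 2 + (load_time + (load_time + (dist_time + (1 + 1)))) + 2)%N.

Lemma wp_load_ball q a r nb N X Q :
  (q < nb)%N -> (a < nb)%N -> (4 < nb)%N -> (d < r)%N -> consts N -> rconsts X ->
  (forall N' X', keep nb r N X N' X' ->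
     beval d X' (vreg r, EReg (r + d)) = mem_ball (N q) (N a) -> Q N' X') ->
  wp (load_ball q a r nb) ball_time N X Q.
Proof.
move=> qnb anb nb4 dr [_ _ _ n3 _] [x0 xd] h; rewrite /beval /= in h.
apply: wp_ifNle; rewrite n3 => ha.
  apply: (wp_time (leq_addr _ _)).
  apply/wp_seq/wp_assignv; first by apply: vbelow_vreg; lia.
  move=> X1 e1 k1; apply: (wp_compile (e := EReg d)) => /=; first lia.
  move=> X2 e2 k2; apply: h.
    by split=> // i ir; rewrite (proj2 k2) ?(proj2 k1) //; lia.
  rewrite /mem_ball -leqn0 ha; congr pair.
    by rewrite (keep_veval _ k2) // e1.
  by rewrite e2 (proj2 k1).
apply: (wp_time (leq_addl _ _)).
apply/wp_seq/wp_load_point => // N1 X1 k1 e1.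
apply/wp_seq/wp_load_point => // N2 X2 k2 e2.
rewrite (proj1 k1) // in e2.
apply: wp_seq; apply: wp_dist; [lia|lia|].
rewrite e2 (keep_veval _ k2) ?e1 //.
move=> X3 e3 k3; apply/wp_seq/wp_RZero/wp_RAdd.
have k13 : keep nb r N X N2 X3.
  split=> i ir; first by rewrite (proj1 k2) ?(proj1 k1).
  by rewrite (proj2 k3) ?(proj2 k2) ?(proj2 k1) //; lia.
apply: h.
  by do 2!(apply: keep_updX; first lia).
rewrite /mem_ball -leqn0 leqNgt ha /= updxx upd_neq; last lia.
rewrite updxx addr0 e3; congr pair; rewrite -e1.
transitivity (veval X3 (vreg r)).
  apply: (veval_ext (r := (r + d)%N)); first exact: vbelow_vreg.
  by move=> i ir; rewrite !upd_neq // ir.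
apply: (veval_ext (r := (r + d)%N)); first exact: vbelow_vreg.
by move=> i ir; rewrite (proj2 k3) ?(proj2 k2) //; lia.
Qed.

Definition bexpr (j : nat) : vexpr * expr :=
  (vreg (j.+1 * d.+1), EReg (j.+1 * d.+1 + d)).

Definition ecenter : vexpr :=
  eradical_center d (bexpr 0) [seq bexpr j | j <- iota 1 d].

Definition center_of (Bl : seq ('rV[R]_d * R)) : 'rV[R]_d :=
  radical_center (nth (mem_ball 0 0) Bl 0) (behead Bl).

Lemma veval_ecenter X Bl : size Bl = d.+1 ->
  (forall j, (j < d.+1)%N -> beval d X (bexpr j) = nth (mem_ball 0 0) Bl j) ->
  veval X ecenter = center_of Bl.
Proof.
move=> sB h; rewrite veval_eradical_center h // -map_comp; congr radical_center.
apply: (@eq_from_nth _ (mem_ball 0 0));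
  rewrite size_map size_iota ?size_behead ?sB //.
move=> j jd; rewrite (nth_map 0%N) ?size_iota // nth_iota //= nth_behead.
by rewrite add1n h.
Qed.

Lemma vbelow_ecenter : vbelow d (d.+2 * d.+1) ecenter.
Proof.
have hb j : (j < d.+1)%N -> vbelow d (d.+2 * d.+1) (bexpr j).1 /\
    below (d.+2 * d.+1) (bexpr j).2.
  move=> jd; have h : (j.+1 * d.+1 + d.+1 <= d.+2 * d.+1)%N.
    by rewrite -mulSnr leq_mul2r ltnS jd orbT.
  by split; [apply: vbelow_vreg|rewrite /=]; lia.
apply: vbelow_eradical_center; try by apply (hb 0%N).
move=> B; have : forall j, List.In j (iota 1 d) -> (j < d.+1)%N.
  move=> j hj; suff : j \in iota 1 d by rewrite mem_iota add1n => /andP[].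
  by elim: (iota 1 d) hj => //= i s IH [->|/IH]; rewrite inE ?eqxx // orbC => ->.
elim: (iota 1 d) => //= i s IH hs [<-|]; first by apply: hb; apply: hs; left.
by apply: IH => j hj; apply: hs; right.
Qed.

(** Specification of the loops of [search]; [Bl] is the part of the tuple already chosen. *)
Fixpoint found (k : nat) (Bl : seq ('rV[R]_d * R)) : bool :=
  if k is k'.+1 then
    has (fun q => has (fun a => found k' (rcons Bl (mem_ball q a))) (iota 0 Nc))
      (iota 0 (Nc + m))
  else test (center_of Bl).

(** The recursion generates [2 * d.+1] nested loops. A level uses four natural registers, two
    counters with their scratch, and [d.+1] real ones; registers 2 and 0 are the loop limits. *)
Fixpoint search (k nb xb : nat) : frag :=
  if k is k'.+1 then
    for_loop nb 2 (for_loop nb.+2 0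
      (load_ball nb nb.+2 xb nb.+4 ;; search k' nb.+4 (xb + d).+1))
  else
    assignv xb ecenter ;; test_frag xb nb (xb + d) ;;
    branch (NJumpLe nb 3) skip (emit (NConst 5 1)).

Fixpoint search_time (k : nat) : nat :=
  if k is k'.+1 then
    (2 + (Nc + m) * (2 + Nc * (ball_time + search_time k' + 4) + 4))%N
  else (vtime ecenter + (test_time + (1 + 2)))%N.

Lemma keep_upd5 nb xb N X N' X' (x y : nat) : (5 < nb)%N ->
  keep nb xb (upd N 5 x) X N' X' -> keep nb xb (upd N 5 y) X (upd N' 5 y) X'.
Proof.
move=> nb5 [k1 k2]; split=> // i ib; have := k1 i ib; rewrite /upd.
by case: eqP.
Qed.

Lemma consts_upd5 N x : consts N -> consts (upd N 5 x).
Proof. by []. Qed.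

Lemma has_iotaS (p : pred nat) i : has p (iota 0 i.+1) = has p (iota 0 i) || p i.
Proof. by rewrite -addn1 iotaD has_cat /= orbF. Qed.

(** Register 5 is the only one below [nb] that may change, so the postcondition is relative to [N]
    updated there. With [i] balls loaded, [k] remain to be chosen. *)
Lemma wp_search k i nb xb Bl (b : bool) N X Q :
  (i + k = d.+1)%N -> (5 < nb)%N -> xb = (i.+1 * d.+1)%N -> size Bl = i ->
  consts N -> rconsts X -> N 5%N = b ->
  (forall j, (j < i)%N -> beval d X (bexpr j) = nth (mem_ball 0 0) Bl j) ->
  (forall N' X', keep nb xb (upd N 5 (b || found k Bl : nat)) X N' X' ->
     Q N' X') ->
  wp (search k nb xb) (search_time k) N X Q.
Proof.
elim: k i nb xb Bl b N X Q => [|k IH] i nb xb Bl b N X Q ik nb5 xbE sB cN cX Nb hB h.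
  rewrite addn0 in ik; rewrite ik in xbE sB hB.
  have dx : (d < xb)%N by rewrite xbE; lia.
  apply/wp_seq/wp_assignv; first by rewrite xbE; exact: vbelow_ecenter.
  rewrite (veval_ecenter sB hB) => X1 e1 k1.
  have cX1 : rconsts X1 by apply: (keep_rconsts _ k1).
  apply/wp_seq/wp_test_frag => //; [lia|lia|].
  rewrite e1 => N2 X2 k2 e2.
  have {}k2 : keep nb xb N X N2 X2.
    split=> j jb; first by rewrite (proj1 k2).
    by rewrite (proj2 k2) ?(proj2 k1) //; lia.
  have [_ _ _ n3 _] : consts N2 by apply: (keep_consts _ k2 cN); lia.
  apply: wp_ifNle; rewrite n3 e2 => ht.
    apply: (@wp_time _ _ _ 0) => //; apply: wp_skip; apply: h => /=.
    move: ht; case: test => // _; rewrite orbF -Nb.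
    split=> j jb; last exact: (proj2 k2).
    by rewrite (proj1 k2) // /upd; case: eqP => // ->.
  apply: wp_NConst; apply: h => /=.
  move: ht; case: test => // _; rewrite orbT.
  apply: (@keep_upd5 _ _ _ _ _ _ (N 5%N)) => //.
  split=> j jb; last exact: (proj2 k2).
  by rewrite (proj1 k2) // /upd; case: eqP => // ->.
have dx : (d < xb)%N by rewrite xbE; lia.
pose F q := has (fun a => found k (rcons Bl (mem_ball q a))) (iota 0 Nc).
apply: (@wp_for _ _ _ _ _ _ (Nc + m) _ _ _ (fun j N' X' =>
  keep nb xb (upd N 5 (b || has F (iota 0 j) : nat)) X N' X')).
- lia.
- by case: cN.
- apply: keep_updN => //; rewrite orbF -Nb.
  by split=> // j jb; rewrite /upd; case: eqP => // ->.
- move=> q N1 X1 qL Nq _ k1.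
  set b1 := b || has F (iota 0 q) in k1.
  have cN1 : consts N1.
    by apply: (keep_consts _ k1); [lia|exact: consts_upd5].
  have cX1 : rconsts X1 by exact: (keep_rconsts dx k1).
  have Nb1 : N1 5%N = b1 by rewrite (proj1 k1) // updxx.
  apply: (@wp_for _ _ _ _ _ _ Nc _ _ _ (fun j N' X' =>
    keep nb.+2 xb (upd N1 5 (b1 || has
      (fun a => found k (rcons Bl (mem_ball q a))) (iota 0 j) : nat)) X1 N' X')).
  + lia.
  + by case: cN1.
  + apply: keep_updN => //; rewrite orbF -Nb1.
    by split=> // j jb; rewrite /upd; case: eqP => // ->.
  + move=> a N2 X2 aN Na _ k2.
    set b2 := b1 || has _ _ in k2.
    have Nq2 : N2 nb = q by rewrite (proj1 k2) ?upd_neq ?Nq //; lia.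
    have cN2 : consts N2.
      by apply: (keep_consts _ k2); [lia|exact: consts_upd5].
    have cX2 : rconsts X2 by exact: (keep_rconsts dx k2).
    have Nb2 : N2 5%N = b2 by rewrite (proj1 k2) ?updxx //; lia.
    apply: wp_seq; apply: wp_load_ball => //; try lia.
    rewrite Na Nq2 => N3 X3 k3 e3.
    have cN3 : consts N3 by apply: (keep_consts _ k3 cN2); lia.
    have cX3 : rconsts X3 by exact: (keep_rconsts dx k3).
    apply: (IH i.+1 _ _ (rcons Bl (mem_ball q a)) b2) => //; try lia.
    * by rewrite size_rcons sB.
    * by rewrite (proj1 k3) //; lia.
    * move=> j; rewrite ltnS leq_eqVlt => /orP[/eqP ->|ji].
        by rewrite /bexpr -xbE e3 nth_rcons sB ltnn eqxx.
      rewrite nth_rcons sB ji -hB //.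
      have jx : (j.+1 * d.+1 + d.+1 <= xb)%N.
        by rewrite xbE -mulSnr leq_mul2r ltnS ji orbT.
      have kX l : (l < xb)%N -> X3 l = X l.
        by move=> lx; rewrite (proj2 k3) ?(proj2 k2) ?(proj2 k1).
      rewrite /beval /=; congr pair; last by apply: kX; lia.
      by apply: (veval_ext (r := xb)) => //; apply: vbelow_vreg; lia.
    move=> N4 X4 k4.
    have kN j : (j < nb.+4)%N -> j != 5 -> N4 j = N2 j.
      move=> jn j5; rewrite (proj1 k4) // upd_neq ?(proj1 k3) //; lia.
    split.
    * by rewrite kN //; lia.
    * by rewrite kN ?(let: And5 n0 _ _ _ _ := cN2 in n0) //; lia.
    do 2!(apply: keep_updN; first lia).
    split=> j jb; last first.
      by rewrite (proj2 k4) ?(proj2 k3) ?(proj2 k2) //; lia.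
    have [->|j5] := eqVneq j 5%N.
      by rewrite (proj1 k4) ?updxx ?has_iotaS ?orbA //; lia.
    rewrite kN //; last lia.
    by rewrite (proj1 k2) // /upd (negPf j5).
  + move=> N2 X2 k2.
    split.
    * by rewrite (proj1 k2) ?upd_neq //; lia.
    * rewrite (proj1 k2) ?upd_neq //; last lia.
      by case: cN1.
    do 2!(apply: keep_updN; first lia).
    split=> j jb; last by rewrite (proj2 k2) ?(proj2 k1).
    rewrite (proj1 k2); last lia.
    have [->|j5] := eqVneq j 5%N.
      by rewrite !updxx has_iotaS orbA.
    rewrite {1}/upd (negPf j5) (proj1 k1) // /upd (negPf j5) //.
- by move=> N' X'; exact: h.
Qed.

Lemma found_sound k Bl : found k Bl -> exists ct, test ct.
Proof.
elim: k Bl => [|k IH] Bl /=; first by exists (center_of Bl).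
by move=> /hasP[q _] /hasP[a _] /IH.
Qed.

Lemma found_complete ids Bl :
  all (fun i => (i.1 < Nc + m) && (i.2 < Nc))%N ids ->
  test (center_of (Bl ++ [seq mem_ball i.1 i.2 | i <- ids])) -> found (size ids) Bl.
Proof.
elim: ids Bl => [|i ids IH] Bl /=; first by rewrite cats0.
move=> /andP[/andP[qL aN] hids] ht.
apply/hasP; exists i.1; first by rewrite mem_iota.
apply/hasP; exists i.2; first by rewrite mem_iota.
by apply: IH => //; rewrite cat_rcons.
Qed.

End Fragments.

(** * The program and its running time *)

Section Decode.
Variables (R : realType) (d n m : nat).
Variables (c : 'I_n.+1 -> 'rV[R]_d) (v : 'I_m -> 'rV[R]_d) (f : nat -> R).
Variable eps : R.
Let M := input_mem c v f eps.
Local Notation mem_point := (mem_point d M).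
Local Notation L := (n.+1 + m)%N.

Lemma coordE (x : 'rV[R]_d) (k : 'I_d) : Defs.coord x k = x 0 k.
Proof.
rewrite /Defs.coord; case: insubP => [k' _ e|]; last by rewrite ltn_ord.
by congr (x 0 _); exact: val_inj.
Qed.

Lemma point_cand (i : 'I_n.+1) : mem_point i = c i.
Proof.
apply/rowP => k; rewrite mxE /M /input_mem.
have d0 : (0 < d)%N by exact: leq_ltn_trans (ltn_ord k).
rewrite ifT.
  by rewrite divnMDl // divn_small // addn0 modnMDl modn_small // inord_val coordE.
apply: (@leq_trans (i.+1 * d)); first by rewrite mulSnr ltn_add2l.
by rewrite leq_mul2r ltn_ord orbT.
Qed.

Lemma point_voter (j : 'I_m) : mem_point (n.+1 + j) = v j.
Proof.
apply/rowP => k; rewrite mxE /M /input_mem.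
have d0 : (0 < d)%N by exact: leq_ltn_trans (ltn_ord k).
have -> : ((n.+1 + j) * d + k = n.+1 * d + (j * d + k))%N by lia.
rewrite ltnNge leq_addr /= addKn ifT.
  rewrite divnMDl // divn_small // addn0 modnMDl modn_small //.
  case: insubP => [j' _ e|]; last by rewrite ltn_ord.
  by rewrite coordE (_ : j' = j) //; exact: val_inj.
apply: (@leq_trans (j.+1 * d)); first by rewrite mulSnr ltn_add2l.
by rewrite leq_mul2r ltn_ord orbT.
Qed.

Lemma mem_score t : (t < n.+1)%N -> M (L * d + t)%N = f t.+1.
Proof.
move=> tn; rewrite /M /input_mem.
have -> : (L * d + t = n.+1 * d + (m * d + t))%N by lia.
by rewrite ltnNge leq_addr /= addKn ltnNge leq_addr /= addKn tn.
Qed.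

Lemma mem_eps : M (L * d + n.+1)%N = eps.
Proof.
rewrite /M /input_mem.
have -> : (L * d + n.+1 = n.+1 * d + (m * d + n.+1))%N by lia.
by rewrite ltnNge leq_addr /= addKn ltnNge leq_addr /= addKn ltnn eqxx.
Qed.

Lemma moved_pointE ct (a : 'I_n.+1) : moved_point M ct a = moved c ct a.
Proof. by rewrite /moved_point /moved point_cand -val_eqE. Qed.

Lemma aheadnE ct x (b a : 'I_n.+1) :
  aheadn M ct x b a = ahead (moved c ct) x b a.
Proof.
rewrite /aheadn /ahead !moved_pointE -!val_eqE /=.
have [e|ba] /= := eqVneq (b : nat) a.
  have -> : b = a by exact: val_inj.
  by rewrite ltxx; case: (a : nat).
case: ltgtP => //=; rewrite ?andbF // andbT => _.
by move: ba; have [->|//] := eqVneq (b : nat) 0%N; rewrite eq_sym => ->.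
Qed.

Lemma ranknE ct x (a : 'I_n.+1) :
  (rankn M n.+1 ct x a).+1 = rank (moved c ct) x a.
Proof.
rewrite /rankn /rank big_mkord; congr _.+1.
rewrite -sum1_card [RHS]big_mkcond; apply: eq_bigr => b _ /=.
by rewrite aheadnE inE; case: ahead.
Qed.

Lemma scorenE ct (a : 'I_n.+1) :
  scoren M n.+1 m ct a = score f (moved c ct) v a.
Proof.
rewrite /scoren big_mkord; apply: eq_bigr => j _.
rewrite mem_score ?ranknE ?rank_le // point_voter // -ranknE.
Qed.

Lemma testP ct : reflect
  (dist2 ct (c ord0) <= eps ^+ 2 /\ wins c v f ct)
  (test M n.+1 m (eps ^+ 2) ct).
Proof.
rewrite /test (point_cand ord0); apply: (iffP andP) => -[h1 h2]; split=> //.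
  move=> a; rewrite -!scorenE; apply: (allP h2).
  by rewrite mem_iota /= ltn_ord.
apply/allP => a; rewrite mem_iota => /= an.
by have := h2 (Ordinal an); rewrite -!scorenE.
Qed.

Lemma foundP : scoring_rule n.+1 f ->
  @found d R M n.+1 m (eps ^+ 2) d.+1 [::] <-> RVPM_constructive c v f eps.
Proof.
move=> fs; split=> [/found_sound[ct /testP] h|[x [xe winx]]]; first by exists ct.
pose bl (i : 'I_L * 'I_n.+1) := mem_ball d M (eps ^+ 2) i.1 i.2.
pose s := enum [pred i | power (bl i) x <= 0].
have sP i : (i \in s) = (power (bl i) x <= 0) by rewrite mem_enum.
have i0s : (ord0, ord0) \in s.
  (* Index [(0, 0)] encodes the displacement ball. Its presence in [s] makes [s] nonempty and later
     bounds the displacement of [w]. *)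
  by rewrite sP /power /bl /= (point_cand ord0) subr_le0.
case s_eq : (size s) => [|k]; first by rewrite (size0nil s_eq) in i0s.
pose g (i : 'I_k.+1) := nth (ord0, ord0) s i.
have gs i : g i \in s by rewrite mem_nth // s_eq.
have [|i0 [t ht]] := @common_point_radical_center R d k (fun i => bl (g i)) x.
  by move=> i; rewrite -sP.
set w := radical_center _ _ in ht.
have inw i : i \in s -> power (bl i) w <= 0.
  move=> si; have ik : (index i s < k.+1)%N by rewrite -s_eq index_mem.
  by have := ht (Ordinal ik); rewrite /g /= nth_index.
(* The base ball and then the [d] direction balls, as the pairs of loop counters that select
   them. *)
pose ids := [seq ((g i).1 : nat, (g i).2 : nat)
  | i <- i0 :: [seq t j | j <- enum 'I_d]].
have -> : d.+1 = size ids by rewrite size_map /= size_map size_enum_ord.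
apply: found_complete.
  by apply/allP => _ /mapP[i _ ->]; rewrite /= !ltn_ord.
have -> : center_of M (eps ^+ 2)
    ([::] ++ [seq mem_ball d M (eps ^+ 2) i.1 i.2 | i <- ids]) = w.
  by rewrite /center_of /= -2!map_comp.
apply/testP; split.
  have := inw _ i0s; rewrite /power /bl /= (point_cand ord0) subr_le0 //.
apply: (wins_mono fs _ winx) => j a a0 hx.
have Lj : (n.+1 + j < L)%N by rewrite ltn_add2l.
have blE : bl (Ordinal Lj, a) = (v j, dist2 (v j) (c a)).
  have a1 : (a : nat) != 0%N by rewrite -val_eqE in a0.
  by rewrite /bl /mem_ball /= (negPf a1) point_voter point_cand.
have := inw (Ordinal Lj, a); rewrite sP blE /power /= !subr_le0 !(dist2C _ (v j)).
by apply.
Qed.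

End Decode.

(** * The complete program *)

Section Program.
Variable d : nat.

(** [eps] is squared once, since all comparisons are between squared distances. Point 0 is loaded
    through register 3, and register 4 becomes [(Nc + m) * d] by repeated addition. *)
Definition setup : frag :=
  emit (NAdd 2 0 1) ;; emit (NConst 3 0) ;; emit (NConst 4 0) ;;
  unroll d (fun=> emit (NAdd 4 4 2)) ;;
  load_point d 3 0 6 ;;
  emit (NAdd 6 4 0) ;; emit (RLoad d 6) ;; emit (RMul d d d) ;;
  emit (NConst 5 0).

Definition main : frag := setup ;; search d d.+1 6 d.+1.

(** The jump to [Halt false] is taken exactly when the answer in register 5 is still 0. *)
Definition program : seq instr :=
  main 0 ++ [:: NJumpLe 5 3 (size (main 0)).+2; Halt true; Halt false].

Definition setup_time : nat :=
  (1 + (1 + (1 + (d * 1 + (load_time d + (1 + (1 + (1 + 1))))))))%N.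

Definition main_time (Nc m : nat) : nat :=
  (setup_time + search_time d Nc m d.+1)%N.

Lemma wp_main (R : realType) (M : nat -> R) (Nc m : nat) N X :
  N 0%N = Nc -> N 1%N = m ->
  wp M main (main_time Nc m) N X (fun N' X' => N' 3%N = 0%N /\
    N' 5%N = @found d R M Nc m (M ((Nc + m) * d + Nc)%N ^+ 2) d.+1 [::]).
Proof.
move=> N0 N1; apply: wp_seq.
apply/wp_seq/wp_NAdd/wp_seq/wp_NConst/wp_seq/wp_NConst/wp_seq.
apply: (@wp_unroll _ _ _ _ _ _ _ _ (fun i N' X' => [/\ N' 0 = Nc, N' 1 = m,
  N' 2 = Nc + m, N' 3 = 0 & N' 4 = i * (Nc + m)]%N)).
- by rewrite /upd /= N0 N1.
- move=> i N' X' _ [n0 n1 n2 n3 n4]; apply: wp_NAdd.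
  by split; rewrite /upd //= n4 n2 mulSnr.
move=> N2 X2 [n0 n1 n2 n3 n4].
have cN2 : consts d Nc m N2 by rewrite /consts n0 n1 n2 n3 n4 mulnC.
apply/wp_seq/wp_load_point => // N3 X3 k3; rewrite n3 => e3.
have cN3 : consts d Nc m N3 by apply: (keep_consts _ k3 cN2).
have [m0 m1 m2 m3 m4] := cN3.
apply/wp_seq/wp_NAdd/wp_seq/wp_RLoad/wp_seq/wp_RMul/wp_NConst.
rewrite !updxx m4 m0.
apply: (@wp_search _ _ _ _ _ (M ((Nc + m) * d + Nc)%N ^+ 2)
  _ 0 _ _ [::] false) => //.
- by rewrite mul1n.
- split; last by rewrite updxx expr2.
  rewrite -e3; apply: (veval_ext (r := d)); first exact: vbelow_vreg.
  by move=> i id; rewrite !upd_neq ?id.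
by move=> N' X' [k1 _]; rewrite !k1.
Qed.

End Program.

(** * Polynomial bounds on running times *)

Definition poly_bounded (F : nat -> nat -> nat) : Prop :=
  exists C K, forall n m, (F n m <= C * (n + m + 1) ^ K)%N.

Lemma poly_boundedC a : poly_bounded (fun _ _ => a).
Proof. by exists a, 0%N => n m; rewrite muln1. Qed.

Lemma poly_bounded_cands : poly_bounded (fun n _ => n.+1).
Proof. by exists 1%N, 1%N => n m; rewrite mul1n expn1; lia. Qed.

Lemma poly_bounded_voters : poly_bounded (fun _ m => m).
Proof. by exists 1%N, 1%N => n m; rewrite mul1n expn1; lia. Qed.

(** The base [n + m + 1] is at least 1, so both exponents can be raised to [K + K']. *)
Lemma poly_boundedD F G : poly_bounded F -> poly_bounded G ->
  poly_bounded (fun n m => F n m + G n m)%N.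
Proof.
move=> [C [K hF]] [C' [K' hG]]; exists (C + C')%N, (K + K')%N => n m.
rewrite mulnDl leq_add // (leq_trans (hF n m), leq_trans (hG n m)) //;
  by rewrite leq_mul2l leq_pexp2l ?orbT ?leq_addr ?leq_addl // addn1.
Qed.

Lemma poly_boundedM F G : poly_bounded F -> poly_bounded G ->
  poly_bounded (fun n m => F n m * G n m)%N.
Proof.
move=> [C [K hF]] [C' [K' hG]]; exists (C * C')%N, (K + K')%N => n m.
by rewrite expnD mulnACA leq_mul.
Qed.

Ltac poly := repeat first
  [ assumption | exact: poly_boundedC | exact: poly_bounded_cands
  | exact: poly_bounded_voters | apply: poly_boundedM | apply: poly_boundedD ].

Lemma poly_bounded_main d : poly_bounded (fun n m => main_time d n.+1 m).
Proof.
have prank : poly_bounded (fun n _ => rank_time d n.+1).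
  by rewrite /rank_time; poly.
have pscore : poly_bounded (fun n m => score_time d n.+1 m).
  by rewrite /score_time; poly.
have ptest : poly_bounded (fun n m => test_time d n.+1 m).
  by rewrite /test_time; poly.
rewrite /main_time; apply: poly_boundedD; first by poly.
(* The nesting depth is a constant, so the degree grows only a fixed number of times. *)
by elim: d.+1 => [|k IH] /=; poly.
Qed.

Theorem theorem6 (R : realType) (d : nat) :
  exists (P : seq instr) (C K : nat),
    forall (n m : nat) (c : 'I_n.+1 -> 'rV[R]_d) (v : 'I_m -> 'rV[R]_d)
           (f : nat -> R) (eps : R),
      no_ties c v -> scoring_rule n.+1 f -> 0 < eps ->
      exists (t : nat) (b : bool),
        (t <= C * (n + m + 1) ^ K)%N /\
        run P t (init_state c v f eps) = Some b /\
        (b <-> RVPM_constructive c v f eps).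
Proof.
(* The 2 pays for the closing jump and the [Halt] that it selects. *)
have [C [K hCK]] := poly_boundedD (poly_bounded_main d) (poly_boundedC 2).
exists (program d), C, K => n m c v f eps _ fs _.
set M := input_mem c v f eps.
have cP : code_at (program d) 0 (main d 0).
  by exists [::], [:: NJumpLe 5 3 (size (main d 0)).+2; Halt true; Halt false].
have [//|//|t [N [X [tT hr [n3 n5]]]]] :=
  @wp_main d R M n.+1 m (upd (upd (fun _ => 0%N) 0 n.+1) 1 m) (fun=> 0) _ _
    (program d) 0 (fun=> 0%N) cP.
exists (t + 2)%N, (@found d R M n.+1 m (eps ^+ 2) d.+1 [::]); split.
  by apply: leq_trans (hCK n m); rewrite leq_add2r.
split; last exact: foundP.
rewrite /init_state hr add0n.
have epsE : M ((n.+1 + m) * d + n.+1)%N = eps by exact: mem_eps.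
rewrite epsE in n5; move: (found _ _ _ _ _ _) n5 => b n5.
have nthP k : nth None (map Some (program d)) (size (main d 0) + k) =
    nth None [:: Some (NJumpLe 5 3 (size (main d 0)).+2);
                 Some (Halt true); Some (Halt false)] k.
  by rewrite map_cat nth_cat size_map ltnNge leq_addr /= addKn.
move: (size _) (program d) nthP => sz P nthP.
have := nthP 0%N; rewrite addn0 /= => ->; rewrite /= n3 n5.
case: b {n5} => /=.
  by rewrite -addn1 nthP.
by rewrite -addn2 nthP.
Qed.
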